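(* Let $n\ge 1$. Consider the cube matroid $M(C^n)$ and the families $\mathcal R$ (signed rectangles) and $\mathcal F$ (positive cocircuits of $\mathrm{Aff}(C^n)$ and their negatives) defined below. The following three conditions are equivalent: (1) $M(C^n)$ has a unique class of orientations, i.e. any two orientations of $M(C^n)$ are reorientations of one another; (2) if $\mathcal M$ is an orientation of $M(C^n)$ whose set of signed cocircuits contains $\mathcal F$, then $\mathcal M=\mathrm{Aff}(C^n)$; (3) if $\mathcal M$ is an orientation of $M(C^n)$ whose set of signed circuits contains $\mathcal R$, then $\mathcal M=\mathrm{Aff}(C^n)$.
   Context: $C^n=\{-1,1\}^n\subseteq\mathbb R^n$ and $[n]=\{1,\dots,n\}$. The cube matroid $M(C^n)$ is the matroid on the ground set $C^n$ whose independent sets are the affinely independent subsets (over $\mathbb R$). An orientation of $M(C^n)$ is an oriented matroid whose underlying matroid is $M(C^n)$. For an oriented matroid $\mathcal M$ on $E$ and $A\subseteq E$, the reorientation ${}_{-A}\mathcal M$ is obtained by reversing the signs of the elements of $A$ in every signed circuit (equivalently every signed cocircuit). $\mathrm{Aff}(C^n)$ is the oriented matroid of affine dependencies of $C^n$: its signed cocircuits are the pairs $\pm(Y^+,Y^-)$ where, for an affine hyperplane $\{\mathbf x:\mathbf x\cdot\mathbf h=b\}$ of $\mathbb R^n$ whose intersection with $C^n$ is a hyperplane of $M(C^n)$, $Y^+=\{\mathbf v\in C^n:\mathbf v\cdot\mathbf h>b\}$ and $Y^-=\{\mathbf v\in C^n:\mathbf v\cdot\mathbf h<b\}$; its signed circuits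 are the pairs $\pm(X^+,X^-)$ where $X$ is a circuit of $M(C^n)$ and $X=X^+\uplus X^-$ is the unique partition with $\mathrm{conv}(X^+)\cap\mathrm{conv}(X^-)\neq\emptyset$. For $\mathbf v\in C^n$ and $I\subseteq[n]$, ${}_{-I}\mathbf v$ denotes the vertex obtained from $\mathbf v$ by negating the coordinates indexed by $I$; for disjoint $I,J$ write ${}_{-IJ}\mathbf v={}_{-(I\cup J)}\mathbf v$. For $i\in[n]$ and $\epsilon\in\{-1,1\}$ let $H_{\epsilon i}=\{\mathbf v\in C^n: v_i=\epsilon\}$ (the facets). $\mathcal F$ is the family of signed sets $(H_{\epsilon i},\emptyset)$ and $(\emptyset,H_{\epsilon i})$ for all $i\in[n]$, $\epsilon\in\{-1,1\}$. $\mathcal R$ is the family of signed sets $\pm R(\mathbf v;I,J)$, where $\mathbf v\in C^n$, $I,J$ are disjoint nonempty subsets of $[n]$, and $R(\mathbf v;I,J)=(\{\mathbf v,{}_{-IJ}\mathbf v\},\{{}_{-I}\mathbf v,{}_{-J}\mathbf v\})$. *)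

(* Defs.v *)
From mathcomp Require Import all_boot all_order all_algebra.
From mathcomp Require Import boolp reals.

Set Implicit Arguments.
Unset Strict Implicit.
Unset Printing Implicit Defensive.

Import Order.TTheory GRing.Theory Num.Theory.

(* A matroid on T is represented by its family of independent sets. *)
Section Matroids.
Variable T : finType.
Implicit Types N : {set {set T}}.

Definition bases N : {set {set T}} := [set B | maxset (mem N) B].

Definition circuits N : {set {set T}} :=
  [set C | minset [pred D | D \notin N] C].

Definition dual_matroid N : {set {set T}} :=
  [set A : {set T} | [exists B in bases N, A \subset ~: B]].

Definition cocircuits N : {set {set T}} := circuits (dual_matroid N).

End Matroids.

(* A signed set (X^+, X^-); the disjointness of its two parts is required
   separately, wherever signed sets are used. *)
Notation signed_set T := ({set T} * {set T})%type.

Section OrientedMatroids.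
Variable T : finType.
Implicit Types (X Y Z : signed_set T) (M : {set signed_set T}).

Definition sdisjoint X : bool := [disjoint X.1 & X.2].

Definition supp X : {set T} := X.1 :|: X.2.

Definition sopp X : signed_set T := (X.2, X.1).

(* An oriented matroid on T is represented by its family of signed circuits;
   the last axiom is weak elimination. *)
Record oriented_matroid M : Prop := OrientedMatroid {
  om_disjoint : forall X, X \in M -> sdisjoint X;
  om_nonempty : forall X, X \in M -> supp X != set0;
  om_symmetric : forall X, X \in M -> sopp X \in M;
  om_incomparable : forall X Y, X \in M -> Y \in M ->
    supp X \subset supp Y -> X = Y \/ X = sopp Y;
  om_elimination : forall X Y e, X \in M -> Y \in M -> X <> sopp Y ->
    e \in X.1 :&: Y.2 ->
    exists Z, [/\ Z \in M, Z.1 \subset (X.1 :|: Y.1) :\ e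
                         & Z.2 \subset (X.2 :|: Y.2) :\ e]
}.

Definition underlying_matroid M : {set {set T}} :=
  [set A : {set T} | [forall X in M, ~~ (supp X \subset A)]].

Definition orientation (N : {set {set T}}) M : Prop :=
  oriented_matroid M /\ underlying_matroid M = N.

(* The elements of supp X :&: supp Y on which X and Y have equal,
   resp. opposite, signs. *)
Definition agreement X Y : {set T} := (X.1 :&: Y.1) :|: (X.2 :&: Y.2).
Definition separation X Y : {set T} := (X.1 :&: Y.2) :|: (X.2 :&: Y.1).

Definition sorthogonal X Y : bool :=
  (agreement X Y == set0) == (separation X Y == set0).

(* The signed cocircuits: the signature of the cocircuits of the underlying
   matroid that is orthogonal to the signed circuits. *)
Definition signed_cocircuits M : {set signed_set T} :=
  [set Y | [&& sdisjoint Y, supp Y \in cocircuits (underlying_matroid M)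
             & [forall X in M, sorthogonal X Y]]].

Definition sreorient (A : {set T}) X : signed_set T :=
  ((X.1 :\: A) :|: (X.2 :&: A), (X.2 :\: A) :|: (X.1 :&: A)).

Definition reorientation (A : {set T}) M : {set signed_set T} :=
  [set sreorient A X | X in M].

End OrientedMatroids.

(* Vertices of the cube {-1,1}^n: the coordinates are encoded by booleans,
   with b standing for the sign (-1) ^+ b, so that true is -1 and
   negation of a coordinate is boolean negation. *)
Notation vertex n := {ffun 'I_n -> bool}.

Section CubeCombinatorics.
Variable n : nat.

Definition flip (I : {set 'I_n}) (v : vertex n) : vertex n :=
  [ffun i => v i (+) (i \in I)].

Definition facet (eps : bool) (i : 'I_n) : {set vertex n} :=
  [set v : vertex n | v i == eps].

Definition facet_family : {set signed_set (vertex n)} :=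
  [set Y | [exists eps, exists i,
     (Y == (facet eps i, set0)) || (Y == (set0, facet eps i))]].

Definition rectangle (v : vertex n) (I J : {set 'I_n}) :
    signed_set (vertex n) :=
  ([set v; flip (I :|: J) v], [set flip I v; flip J v]).

Definition rectangle_family : {set signed_set (vertex n)} :=
  [set X | [exists v, exists I, exists J,
     [&& I != set0, J != set0, [disjoint I & J]
       & (X == rectangle v I J) || (X == sopp (rectangle v I J))]]].

End CubeCombinatorics.

Section CubeGeometry.
Local Open Scope ring_scope.
Variables (R : realType) (n : nat).
Implicit Type A : {set vertex n}.

Definition point (v : vertex n) : 'rV[R]_n := \row_i (-1) ^+ v i.

Definition affinely_independent A : Prop :=
  forall c : vertex n -> R,
    \sum_(v in A) c v = 0 -> \sum_(v in A) c v *: point v = 0 ->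
    forall v, v \in A -> c v = 0.

Definition cube_matroid : {set {set vertex n}} :=
  [set A | `[< affinely_independent A >]].

Definition in_conv A (x : 'rV[R]_n) : Prop :=
  exists w : vertex n -> R,
    [/\ forall v, v \in A -> 0 <= w v, \sum_(v in A) w v = 1
      & x = \sum_(v in A) w v *: point v].

Definition aff_cube : {set signed_set (vertex n)} :=
  [set X | [&& sdisjoint X, supp X \in circuits cube_matroid
             & `[< exists x, in_conv X.1 x /\ in_conv X.2 x >]]].

End CubeGeometry.

(* Main.v *)
Require Import Defs.
From mathcomp Require Import all_boot all_order all_algebra.
From mathcomp Require Import boolp reals.
From mathcomp Require Import ring lra.

(* Everything rests on one consequence of weak elimination: if two circuits X, Y
   lie in S + {v, w}, no circuit in S + {v, w} contains exactly one of v and w,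
   and S contains at most one circuit up to sign, then the signs of v and w agree
   in X iff they agree in Y.

   (1) => (2): rectangles meeting a facet in a given pair of vertices show that a
   reorientation of Aff(C^n) keeping all facets positive reorients all or none of
   the elements of each circuit.

   (2) => (3): two vertices v, w of a facet H have opposite signs in every circuit
   meeting H in {v, w}; this holds for a rectangle and propagates along two basis
   exchanges in the opposite facet. A circuit with constant sign on H could then
   be reduced by elimination until it misses H, inside a basis of the opposite
   facet.

   (3) => (1): in an orientation, say that {u, w} is monochromatic if u and w have
   the same sign in a rectangle having {u, w} as an edge; this does not depend on
   the rectangle. Over F_2 this is a function on the pairs of non-antipodal
   vertices that vanishes on triangles (by elimination between parallel edges) and
   on rectangles. It is therefore the coboundary of a function on the vertices,
   and reorienting by this function makes every rectangle have its signs in R. *)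

Set Implicit Arguments.
Unset Strict Implicit.
Unset Printing Implicit Defensive.

Import Order.TTheory GRing.Theory Num.Theory.

(** * Elimination on pairs of elements *)

Section SignedCircuits.
Variables (T : finType) (M : {set signed_set T}).
Hypothesis omM : oriented_matroid M.
Implicit Types (X Y Z W : signed_set T) (F : {set T}).

(** Signs are booleans, [true] for the negative part, so that they are compared by exclusive or. The
    value is meaningful only on the support. *)
Definition sgn X x : bool := x \in X.2.

Lemma supp_sopp X : supp (sopp X) = supp X.
Proof. by rewrite /supp setUC. Qed.

Lemma sgn_fst X x : X \in M -> x \in supp X -> (x \in X.1) = ~~ sgn X x.
Proof.
move=> /(om_disjoint omM) dX; rewrite inE /sgn.
case: (boolP (x \in X.2)) => [x2 _|_]; last by rewrite orbF => ->.
by apply/negbTE/negP => x1; move: (disjointFr dX x1); rewrite x2.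
Qed.

Lemma sgn_sopp X x : X \in M -> x \in supp X -> sgn (sopp X) x = ~~ sgn X x.
Proof. by move=> XM xX; rewrite -sgn_fst. Qed.

(** Circuits with equal supports are equal or opposite, and negation preserves the relative sign of
    two elements. *)
Lemma supp_eq_sgn X Y x y : X \in M -> Y \in M -> supp X = supp Y ->
  x \in supp X -> y \in supp X ->
  sgn X x (+) sgn X y = sgn Y x (+) sgn Y y.
Proof.
move=> XM YM eXY xX yX.
have [|->//|->] := om_incomparable omM XM YM; first by rewrite eXY.
by rewrite !sgn_sopp -?eXY // addNb addbN negbK.
Qed.

Lemma om_supp_eq X Y : X \in M -> Y \in M -> supp X \subset supp Y ->
  supp X = supp Y.
Proof.
by move=> XM YM s; case: (om_incomparable omM XM YM s) => ->; rewrite ?supp_sopp.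
Qed.

(** Weak elimination in a form symmetric in [X] and [Y]: distinct supports exclude [X = sopp Y], and
    swapping the circuits exchanges the two sign patterns at [e]. *)
Lemma sgn_elimination X Y e : X \in M -> Y \in M -> supp X != supp Y ->
  e \in supp X -> e \in supp Y -> sgn X e != sgn Y e ->
  exists Z, [/\ Z \in M, e \notin supp Z &
    forall x, x \in supp Z -> (x \in supp X /\ sgn Z x = sgn X x) \/
                              (x \in supp Y /\ sgn Z x = sgn Y x)].
Proof.
have main X' Y' : X' \in M -> Y' \in M -> supp X' != supp Y' ->
  e \in X'.1 -> e \in Y'.2 ->
  exists Z, [/\ Z \in M, e \notin supp Z &
    forall x, x \in supp Z -> (x \in supp X' /\ sgn Z x = sgn X' x) \/
                              (x \in supp Y' /\ sgn Z x = sgn Y' x)].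
  move=> XM YM nXY eX eY.
  have nop : X' <> sopp Y' by move=> E; rewrite E supp_sopp eqxx in nXY.
  have eI : e \in X'.1 :&: Y'.2 by rewrite inE eX.
  have [Z [ZM Z1 Z2]] := om_elimination omM XM YM nop eI.
  exists Z; split=> //.
    by apply/negP; rewrite inE => /orP[/(subsetP Z1)|/(subsetP Z2)]; rewrite !inE eqxx.
  move=> x xZ; case: (boolP (sgn Z x)) => sx.
    move: (subsetP Z2 _ sx); rewrite !inE => /andP[_ /orP[x2|x2]].
      by left; rewrite x2 orbT /sgn x2.
    by right; rewrite x2 orbT /sgn x2.
  have x1 : x \in Z.1 by rewrite sgn_fst.
  move: (subsetP Z1 _ x1); rewrite !inE => /andP[_ /orP[x2|x2]].
    left; rewrite x2; split=> //; apply/esym/negbTE.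
    by rewrite -sgn_fst // inE x2.
  right; rewrite x2; split=> //; apply/esym/negbTE.
  by rewrite -sgn_fst // inE x2.
move=> XM YM nXY eX eY; case: (boolP (sgn X e)) => sX; case: (boolP (sgn Y e)) => sY //= _.
  have eY1 : e \in Y.1 by rewrite sgn_fst.
  rewrite eq_sym in nXY.
  have [Z [ZM eZ hZ]] := main _ _ YM XM nXY eY1 sX.
  by exists Z; split=> // x /hZ; tauto.
have eX1 : e \in X.1 by rewrite sgn_fst.
exact: (main _ _ XM YM nXY eX1 sY).
Qed.

(* Eliminating v between X and Y or -Y also removes w, since a circuit cannot
   contain exactly one of them; this computes the signs of the circuit in F. *)
Lemma eliminate_pair X Y F v w x y : X \in M -> Y \in M ->
  v \in supp X -> v \in supp Y ->
  supp X \subset F :|: [set v; w] -> supp Y \subset F :|: [set v; w] ->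
  (forall Z, Z \in M -> supp Z \subset F :|: [set v; w] ->
     w \in supp Z -> v \in supp Z) ->
  (forall Z, Z \in M -> supp Z \subset F -> (x \in supp Z) && (y \in supp Z)) ->
  x \in supp X -> x \notin supp Y -> y \in supp Y -> y \notin supp X ->
  exists Z, [/\ Z \in M, supp Z \subset F & sgn Z x (+) sgn Z y =
      ~~ (sgn X v (+) sgn X x (+) sgn Y v (+) sgn Y y)].
Proof.
move=> XM YM vX vY sX sY hF hxy xX xY yY yX.
have nXY : supp X != supp Y by apply: contra xY => /eqP <-.
have main Y' : Y' \in M -> supp Y' = supp Y -> sgn X v != sgn Y' v ->
  exists Z, [/\ Z \in M, supp Z \subset F & sgn Z x (+) sgn Z y =
      ~~ (sgn X v (+) sgn X x (+) sgn Y' v (+) sgn Y' y)].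
  move=> YM' eY nv; have vY' : v \in supp Y' by rewrite eY.
  have nXY' : supp X != supp Y' by rewrite eY.
  have [Z [ZM vZ hZ]] := sgn_elimination XM YM' nXY' vX vY' nv.
  have sZ : supp Z \subset F :|: [set v; w].
    apply/subsetP=> u /hZ[[uX _]|[uY _]]; first exact: (subsetP sX).
    by rewrite eY in uY; apply: (subsetP sY).
  have wZ : w \notin supp Z by apply: contra vZ; apply: hF.
  have ZF : supp Z \subset F.
    apply/subsetP=> u uZ; move: (subsetP sZ _ uZ); rewrite in_setU in_set2.
    case/or3P=> // /eqP E; first by rewrite -E uZ in vZ.
    by rewrite -E uZ in wZ.
  have /andP[xZ yZ] := hxy _ ZM ZF.
  exists Z; split=> //.
  have [[_ ->]|[]] := hZ _ xZ; last by rewrite eY (negbTE xY).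
  have [[]|[_ ->]] := hZ _ yZ; first by rewrite (negbTE yX).
  by move: nv; do 4!case: (sgn _ _).
have [E|] := eqVneq (sgn X v) (sgn Y v); last exact: main.
have nop : sgn X v != sgn (sopp Y) v by rewrite sgn_sopp // E; case: (sgn _ _).
have [Z [ZM ZF e]] := main _ (om_symmetric omM YM) (supp_sopp Y) nop.
exists Z; split=> //; rewrite e.
by rewrite !sgn_sopp //; do 4!case: (sgn _ _).
Qed.

(** Eliminating [v] and eliminating [w] give two circuits inside [F], which have the same support.
    The relative sign of [x] and [y] is determined by the signs at [v] in the first and by those at
    [w] in the second; equating the two leaves only the signs at [v] and [w]. *)
Lemma pair_sgn X Y F v w x y : X \in M -> Y \in M ->
  v \in supp X -> v \in supp Y -> w \in supp X -> w \in supp Y ->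
  supp X \subset F :|: [set v; w] -> supp Y \subset F :|: [set v; w] ->
  (forall Z, Z \in M -> supp Z \subset F :|: [set v; w] ->
     (v \in supp Z) = (w \in supp Z)) ->
  (forall Z, Z \in M -> supp Z \subset F -> (x \in supp Z) && (y \in supp Z)) ->
  (forall Z W, Z \in M -> W \in M -> supp Z \subset F -> supp W \subset F ->
     supp Z = supp W) ->
  x \in supp X -> x \notin supp Y -> y \in supp Y -> y \notin supp X ->
  sgn X v (+) sgn X w = sgn Y v (+) sgn Y w.
Proof.
move=> XM YM vX vY wX wY sX sY hF hxy hu xX xY yY yX.
have hv Z : Z \in M -> supp Z \subset F :|: [set v; w] -> w \in supp Z -> v \in supp Z.
  by move=> ZM ZF; rewrite (hF Z).
have hw Z : Z \in M -> supp Z \subset F :|: [set w; v] -> v \in supp Z -> w \in supp Z.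
  by rewrite [[set w; v]]setUC => ZM ZF; rewrite (hF Z).
have [Z [ZM ZF eZ]] := eliminate_pair XM YM vX vY sX sY hv hxy xX xY yY yX.
rewrite [[set v; w]]setUC in sX sY.
have [W [WM WF eW]] := eliminate_pair XM YM wX wY sX sY hw hxy xX xY yY yX.
have /andP[xZ yZ] := hxy _ ZM ZF.
have := supp_eq_sgn ZM WM (hu _ _ ZM WM ZF WF) xZ yZ.
by rewrite eZ eW; do 6!case: (sgn _ _).
Qed.

Lemma om_circuit X : X \in M -> supp X \in circuits (underlying_matroid M).
Proof.
move=> XM; rewrite inE; apply/minsetP; split=> [|B].
  by rewrite !inE; apply/forallPn; exists X; rewrite XM subxx.
rewrite !inE => /forallPn[Y]; rewrite negb_imply negbK => /andP[YM YB] BX.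
by apply/eqP; rewrite eqEsubset BX -(om_supp_eq YM XM (subset_trans YB BX)).
Qed.

Lemma circuit_om C : C \in circuits (underlying_matroid M) ->
  exists2 X, X \in M & supp X = C.
Proof.
rewrite inE => /minsetP[]; rewrite !inE => /forallPn[X].
rewrite negb_imply negbK => /andP[XM XC] Cmin; exists X => //; apply: Cmin => //.
by rewrite !inE; apply/forallPn; exists X; rewrite XM subxx.
Qed.

Lemma dependent_om A : A \notin underlying_matroid M ->
  exists2 X, X \in M & supp X \subset A.
Proof.
rewrite !inE => /forallPn[X]; rewrite negb_imply negbK => /andP[XM XA].
by exists X.
Qed.

End SignedCircuits.

(** * Affine dependencies of the cube *)

Section AffineDependencies.
Local Open Scope ring_scope.
Variables (R : realType) (n : nat).
Implicit Types (c d : vertex n -> R) (A B C F : {set vertex n}).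
Implicit Types (u v w x y z : vertex n) (I J : {set 'I_n}).

Notation N := (cube_matroid R n).

(* Given that the total weight vanishes, the i-th coordinate of the weighted
   sum of points is -2 times the weight of the facet [v i = true]. *)
Definition affine_dep c : Prop :=
  \sum_v c v = 0 /\ forall i, \sum_(v : vertex n | v i) c v = 0.

Definition csupp c : {set vertex n} := [set v | c v != 0].

Lemma affine_dep_lin c d (a b : R) : affine_dep c -> affine_dep d ->
  affine_dep (fun v => a * c v + b * d v).
Proof.
move=> [c0 c1] [d0 d1]; split=> [|i]; rewrite big_split /= -!mulr_sumr.
  by rewrite c0 d0 !mulr0 addr0.
by rewrite c1 d1 !mulr0 addr0.
Qed.

Lemma affine_dep_facet c (i : 'I_n) (eps : bool) :
  affine_dep c -> \sum_(v : vertex n | v i == eps) c v = 0.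
Proof.
case: eps => -[c0 c1].
  by rewrite -[RHS](c1 i); apply: eq_bigl => v; rewrite eqb_id.
move: c0; rewrite (bigID (fun v : vertex n => v i)) /= c1 add0r => c0.
by rewrite -[RHS]c0; apply: eq_bigl => v; rewrite eqbF_neg.
Qed.

(** The weights on a facet sum to zero, so a facet cannot contain exactly one vertex of the
    support. *)
Lemma affine_dep_single c v (i : 'I_n) : affine_dep c ->
  (forall u, u i = v i -> u != v -> c u = 0) -> c v = 0.
Proof.
move=> /(affine_dep_facet i (v i)); rewrite (bigD1 v) //= => E c0.
by move: E; rewrite big1 ?addr0 // => u /andP[/eqP e]; apply: c0.
Qed.

Lemma affine_depE c :
  affine_dep c <-> \sum_v c v = 0 /\ \sum_v c v *: point R v = 0.
Proof.
have E i : (\sum_v c v *: point R v) 0 i = \sum_v c v - 2 * \sum_(v : vertex n | v i) c v.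
  rewrite summxE [X in 2 * X]big_mkcond mulr_sumr -sumrB; apply: eq_bigr => v _.
  by rewrite !mxE; case: (v i) => /=; rewrite ?expr0 ?expr1; ring.
split=> -[c0 c1]; split=> //.
  by apply/rowP=> i; rewrite E c0 c1 mulr0 subr0 mxE.
move=> i; move/rowP/(_ i): c1; rewrite E c0 mxE sub0r => /eqP.
by rewrite oppr_eq0 mulf_eq0 pnatr_eq0 => /eqP.
Qed.

(** Weights are functions on the whole cube with support in [A], so that dependencies on different
    sets can be combined without changing the range of summation. *)
Lemma cube_indepP A : reflect
  (forall c, affine_dep c -> csupp c \subset A -> forall v, c v = 0) (A \in N).
Proof.
have sumA (V : lmodType R) c (f : (vertex n) -> V) : csupp c \subset A ->
    \sum_(v in A) c v *: f v = \sum_v c v *: f v.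
  move=> cA; rewrite [RHS](bigID (mem A)) /= [X in _ = _ + X]big1 ?addr0 //.
  move=> v; apply: contraNeq; rewrite scaler_eq0 negb_or => /andP[cv _].
  by apply: (subsetP cA); rewrite inE.
have sumA1 c : csupp c \subset A -> \sum_(v in A) c v = \sum_v c v.
  move=> cA; have := sumA (GRing.regular R) c (fun=> 1) cA.
  have E v : c v *: (1 : GRing.regular R) = c v by rewrite /GRing.scale /= mulr1.
  by under eq_bigr do rewrite E; under [in RHS]eq_bigr do rewrite E.
rewrite inE; apply: (iffP (asboolP _)) => [ind c|ind c].
  move=> /affine_depE[c0 c1] cA v; case: (boolP (v \in A)) => vA.
    by apply: (ind c _ _ v vA); rewrite ?sumA1 ?sumA.
  by apply: contraNeq vA => cv; apply: (subsetP cA); rewrite inE.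
move=> c0 c1 v vA; pose d v := if v \in A then c v else 0.
have dA : csupp d \subset A.
  by apply/subsetP=> u; rewrite inE /d; case: ifP; rewrite ?eqxx.
have : d v = 0.
  apply: (ind _ _ dA v); apply/affine_depE; split.
    by rewrite -sumA1 // -[RHS]c0; apply: eq_bigr => u; rewrite /d => ->.
  by rewrite -sumA // -[RHS]c1; apply: eq_bigr => u; rewrite /d => ->.
by rewrite /d vA.
Qed.

Lemma cube_dep A : A \notin N ->
  exists c, [/\ affine_dep c, csupp c \subset A & exists v, c v != 0].
Proof.
move=> /cube_indepP/existsNP[c /not_implyP[dc /not_implyP[cA /existsNP[v /eqP cv]]]].
by exists c; split=> //; exists v.
Qed.

Lemma cube_indep_sub A B : A \subset B -> B \in N -> A \in N.
Proof.
move=> AB /cube_indepP ind; apply/cube_indepP=> c dc cA; apply: ind => //.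
exact: subset_trans AB.
Qed.

Lemma circuit_notin C : C \in circuits N -> C \notin N.
Proof. by rewrite inE => /minsetP[]. Qed.

Lemma circuit_del C v : C \in circuits N -> v \in C -> C :\ v \in N.
Proof.
rewrite inE => /minsetP[_ Cmin] vC; apply: contraLR vC => CvN.
have <- : C :\ v = C by apply: Cmin => //; apply: subsetDl.
by rewrite !inE eqxx.
Qed.

Lemma circuitI C : C \notin N -> (forall v, v \in C -> C :\ v \in N) ->
  C \in circuits N.
Proof.
move=> CN Cv; rewrite inE; apply/minsetP; split=> // B BN BC.
apply/eqP; rewrite eqEsubset BC /=; apply/subsetP=> v vC; apply: contraLR BN => vB.
rewrite inE negbK; apply: cube_indep_sub (Cv _ vC).
by rewrite subsetD1 BC.
Qed.

Lemma circuit_sub C D : C \in circuits N -> D \in circuits N ->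
  C \subset D -> C = D.
Proof.
by move=> /circuit_notin CN; rewrite inE => /minsetP[_ Dmin] CD; apply: Dmin.
Qed.

Lemma circuit_in A : A \notin N -> exists2 C, C \in circuits N & C \subset A.
Proof.
move=> AN; have [C CA CB] := @minset_exists _ [pred D | D \notin N] A AN.
by exists C; rewrite ?inE.
Qed.

Lemma circuit_dep C : C \in circuits N -> exists2 c, affine_dep c & csupp c = C.
Proof.
move=> CC; have [c [dc cC [v cv]]] := cube_dep (circuit_notin CC).
exists c => //; apply/eqP; rewrite eqEsubset cC /=; apply/subsetP=> u uC.
rewrite inE; apply: contra cv => /eqP cu; apply/eqP.
have /cube_indepP := circuit_del CC uC; apply=> //.
by rewrite subsetD1 cC inE cu eqxx.
Qed.

Lemma circuit_single C v (i : 'I_n) : C \in circuits N -> v \in C ->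
  exists u, [/\ u \in C, u != v & u i = v i].
Proof.
move=> /circuit_dep[c dc <-] vC; apply/not_existsP=> h.
move: (vC); rewrite inE (affine_dep_single (i := i) dc) ?eqxx // => u ui uv.
by apply/eqP/negPn/negP => cu; apply: (h u); split; rewrite ?inE.
Qed.

(** The combination of [c] and [d] that cancels at [v] has its support in the independent set
    [A :\ v], hence is zero. *)
Lemma affine_dep_eq A v c d : A :\ v \in N -> affine_dep c -> affine_dep d ->
  csupp c \subset A -> csupp d \subset A -> forall u, d v * c u = c v * d u.
Proof.
move=> /cube_indepP Av dc dd cA dA u; apply/eqP; rewrite -subr_eq0 -mulNr; apply/eqP.
apply: (Av (fun u => d v * c u + (- c v) * d u)); first exact: affine_dep_lin.
rewrite subsetD1 inE negbK mulNr mulrC subrr eqxx andbT.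
apply/subsetP=> w; apply: contraLR => wA; rewrite inE negbK.
have out b : csupp b \subset A -> b w = 0.
  by move=> bA; apply: contraNeq wA => bw; apply: (subsetP bA); rewrite inE.
by rewrite !out // !mulr0 addr0.
Qed.

(** Both circuits contain [v], since [A :\ v] is independent; their dependencies are then
    proportional and have the same support. *)
Lemma circuit_uniq A v C D : A :\ v \in N -> C \in circuits N ->
  D \in circuits N -> C \subset A -> D \subset A -> C = D.
Proof.
move=> Av CC DC; have [c dc cC] := circuit_dep CC; have [d dd dD] := circuit_dep DC.
have inC E : E \in circuits N -> E \subset A -> v \in E.
  move=> EC EA; apply: contraR (circuit_notin EC) => vE.
  by apply: cube_indep_sub Av; rewrite subsetD1 EA.
move=> CA DA; have := inC _ CC CA; have := inC _ DC DA.
rewrite -{1}cC -{1}dD !inE => dv cv.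
rewrite -cC -dD; apply/setP=> u; rewrite !inE; congr (~~ _).
rewrite -cC in CA; rewrite -dD in DA.
have := congr1 (fun t => t == 0) (affine_dep_eq Av dc dd CA DA u).
by rewrite !mulf_eq0 (negbTE dv) (negbTE cv).
Qed.

(** A coordinate separating two of the points puts one of the three alone in a facet, which forces
    its weight to vanish; the remaining two points are treated in the same way. The points may
    coincide. *)
Lemma cube_indep3 x y z : [set x; y; z] \in N.
Proof.
have dis (u v : vertex n) : u != v -> exists i, u i != v i.
  by move/eqP/ffunP/existsNP=> [i /eqP]; exists i.
have two c u v : affine_dep c -> csupp c \subset [set u; v] -> forall t, c t = 0.
  move=> dc cs t; apply/eqP/negPn/negP => ct.
  have c0 t' : t' != u -> t' != v -> c t' = 0.
    move=> t1 t2; apply: contraNeq t1 => ct'.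
    have : t' \in [set u; v] by apply: (subsetP cs); rewrite inE.
    by rewrite !inE (negbTE t2) orbF.
  have [E|/dis[i ne]] := eqVneq u v.
    subst v.
    have c1 : \sum_v c v = c u by rewrite (bigD1 u) //= big1 ?addr0 // => w wu; exact: c0.
    have cu : c u = 0 by rewrite -c1; case: dc.
    have [E|tu] := eqVneq t u; first by rewrite E cu eqxx in ct.
    by rewrite c0 ?eqxx in ct.
  have cu : c u = 0.
    apply: (affine_dep_single (i := i) dc) => t' e t'u; apply: c0 => //.
    by apply: contra ne => /eqP <-; rewrite e.
  have cv : c v = 0.
    apply: (affine_dep_single (i := i) dc) => t' e t'u; apply: c0 => //.
    by apply: contra ne => /eqP <-; rewrite e.
  have [E|tu] := eqVneq t u; first by rewrite E cu eqxx in ct.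
  have [E|tv] := eqVneq t v; first by rewrite E cv eqxx in ct.
  by rewrite c0 ?eqxx in ct.
apply/cube_indepP=> c dc cs.
have [E|/dis[i ne]] := eqVneq x y.
  by apply: (two _ y z dc _); rewrite E setUid in cs; exact: cs.
have c0 t : t != x -> t != y -> t != z -> c t = 0.
  move=> t1 t2 t3; apply: contraNeq t1 => ct'.
  have : t \in [set x; y; z] by apply: (subsetP cs); rewrite inE.
  by rewrite !inE (negbTE t2) (negbTE t3) !orbF.
(* The third point [z] lies in the facet of [x] or in that of [y]; the other of these two points is
   alone in its facet. *)
have [zi|zi] := boolP (z i == x i).
  have cy : c y = 0.
    apply: (affine_dep_single (i := i) dc) => t e ty; apply: c0 => //.
      by apply: contra ne => /eqP <-; rewrite e.
    by apply: contra ne => /eqP E; rewrite -(eqP zi) -E e.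
  apply: (two _ x z dc _); apply/subsetP=> t tc; move: (subsetP cs _ tc).
  rewrite !inE => /orP[/orP[->//|/eqP E]|->]; last by rewrite orbT.
  by move: tc; rewrite inE E cy eqxx.
have cx : c x = 0.
  apply: (affine_dep_single (i := i) dc) => t e ty; apply: c0 => //.
    by apply: contra ne => /eqP <-; rewrite e.
  by apply: contra zi => /eqP E; rewrite -E e.
apply: (two _ y z dc _); apply/subsetP=> t tc; move: (subsetP cs _ tc).
rewrite !inE => /orP[/orP[/eqP E|->//]|->]; last by rewrite orbT.
by move: tc; rewrite inE E cx eqxx.
Qed.

Lemma flipE I v i : flip I v i = v i (+) (i \in I).
Proof. by rewrite ffunE. Qed.

Lemma supp_rectangle v I J : supp (rectangle v I J) =
  [set v; flip (I :|: J) v; flip I v; flip J v].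
Proof. by rewrite /supp /= setUA. Qed.

Lemma flip_neq I v : I != set0 -> flip I v != v.
Proof.
case/set0Pn=> i iI; apply/eqP=> /ffunP/(_ i); rewrite flipE iI.
by case: (v i).
Qed.

Lemma flip_inj v : injective (fun I => flip I v).
Proof.
move=> I J /ffunP E; apply/setP=> i; have := E i; rewrite !flipE.
by case: (v i) (i \in I) (i \in J) => [] [] [].
Qed.

Lemma circuit_neq0 C : C \in circuits N -> C != set0.
Proof.
apply: contraTneq => ->; apply/negP => /circuit_notin/negP; apply.
have v : vertex n by exact: [ffun=> true].
exact: cube_indep_sub (sub0set _) (cube_indep3 v v v).
Qed.

(** * Rectangles as circuits *)

Section Rectangle.
Variables (v : vertex n) (I J : {set 'I_n}).
Hypotheses (I0 : I != set0) (J0 : J != set0) (dIJ : [disjoint I & J]).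

(** The parallelogram relation: opposite corners of a rectangle have the same midpoint. *)
Definition rectangle_weight u : R :=
  ((u == v)%:R + (u == flip (I :|: J) v)%:R)
  - ((u == flip I v)%:R + (u == flip J v)%:R).

Lemma rectangle_sdisjoint : sdisjoint (rectangle v I J).
Proof.
rewrite /sdisjoint disjoints_subset; apply/subsetP=> u.
rewrite !inE => /orP[]/eqP->.
  by rewrite eq_sym negb_or flip_neq // eq_sym flip_neq.
have h (K L : {set 'I_n}) : L != set0 -> [disjoint K & L] -> K :|: L != K.
  move=> /set0Pn[i iL] dKL; apply/eqP=> /setP/(_ i); rewrite inE iL orbT.
  by rewrite (disjointFl dKL).
rewrite !(inj_eq (@flip_inj v)) negb_or h // setUC h //.
by rewrite disjoint_sym.
Qed.

Lemma rectangle_weight_dep : affine_dep rectangle_weight.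
Proof.
have one P w : \sum_(u | P u) (u == w)%:R = (P w)%:R :> R.
  rewrite big_mkcond (bigD1 w) //= big1 ?addr0; last first.
    by move=> u /negbTE ->; case: (P u).
  by rewrite eqxx; case: (P w).
split=> [|i]; rewrite sumrB !big_split /= !one ?subrr //.
rewrite !flipE inE; have := disjointFr dIJ (x := i).
case: (i \in I) => [->//|_] /=; case: (i \in J) => /=; rewrite ?addbT ?addbF; ring.
Qed.

(** The parallelogram relation makes the four corners dependent, while any three vertices of the
    cube are independent. *)
Lemma rectangle_circuit : supp (rectangle v I J) \in circuits N.
Proof.
have csQ : csupp rectangle_weight \subset supp (rectangle v I J).
  apply/subsetP=> u; rewrite supp_rectangle !inE; apply: contraR.
  rewrite !negb_or => /andP[/andP[/andP[/negbTE a /negbTE b] /negbTE c] /negbTE d].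
  by rewrite /rectangle_weight a b c d !addr0 subrr.
have pos u : u \in [set v; flip (I :|: J) v] -> rectangle_weight u != 0.
  move=> u1; have := disjointFr rectangle_sdisjoint u1; rewrite /= in_set2.
  move: u1; rewrite /rectangle_weight in_set2.
  by do 4!case: (u == _) => //=; rewrite ?addr0 ?subr0 ?add0r ?oner_eq0 //
    -(natrD _ 1 1) pnatr_eq0.
apply: circuitI.
  apply/negP => /cube_indepP/(_ _ rectangle_weight_dep csQ v)/eqP.
  by apply/negP; apply: pos; rewrite !inE eqxx.
have sub3 x y z w u : u \in [set x; y; z; w] -> [set x; y; z; w] :\ u \in N.
  move=> uQ; have: [|| u == x, u == y, u == z | u == w] by move: uQ; rewrite !inE -!orbA.
  case/or4P => /eqP->;
    [apply: cube_indep_sub (cube_indep3 y z w)|apply: cube_indep_sub (cube_indep3 x z w)|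
     apply: cube_indep_sub (cube_indep3 x y w)|apply: cube_indep_sub (cube_indep3 x y z)];
    by apply/subsetP=> t; rewrite !inE; do 4!case: (t == _).
by move=> u; rewrite supp_rectangle; apply: sub3.
Qed.
End Rectangle.

End AffineDependencies.

(** * The affine orientation *)

Section AffineOrientation.
Local Open Scope ring_scope.
Variables (R : realType) (n : nat).
Implicit Types (c d g h : vertex n -> R) (A B C F : {set vertex n}).
Implicit Types (u v w x y z : vertex n) (I J : {set 'I_n}).

Notation N := (cube_matroid R n).

Definition dep_signs c : signed_set (vertex n) :=
  ([set v | 0 < c v], [set v | c v < 0]).

Lemma supp_dep_signs c : supp (dep_signs c) = csupp c.
Proof. by apply/setP=> v; rewrite !inE neq_lt orbC. Qed.

Lemma dep_signs_scale c d (r : R) : 0 < r -> (forall u, c u = r * d u) ->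
  dep_signs c = dep_signs d.
Proof.
move=> r0 E; congr pair; apply/setP=> u; rewrite !inE E.
  by rewrite pmulr_rgt0.
by rewrite pmulr_rlt0.
Qed.

Lemma dep_signsN c : dep_signs (fun u => - c u) = sopp (dep_signs c).
Proof. by congr pair; apply/setP=> u; rewrite !inE ?oppr_gt0 ?oppr_lt0. Qed.

Lemma affine_depN c : affine_dep c -> affine_dep (fun u => - c u).
Proof.
move=> dc; have := affine_dep_lin (-1) 0 dc dc.
by congr affine_dep; apply/funext => u; ring.
Qed.

(** A common point of the two convex hulls yields a dependency by subtracting its two convex
    combinations. Conversely, the positive and negative parts of a dependency have the same total
    weight, and dividing by it gives a common point. *)
Lemma aff_cubeP X : X \in aff_cube R n <->
  supp X \in circuits N /\ exists2 c, affine_dep c & X = dep_signs c.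
Proof.
rewrite inE; split=> [/and3P[dX CX /asboolP[p [[a [a0 a1 ap]] [b [b0 b1 bp]]]]]|].
  split=> //.
  pose f A (t : vertex n -> R) v := if v \in A then t v else 0.
  have sumf A t : \sum_v f A t v = \sum_(v in A) t v.
    by rewrite [RHS]big_mkcond.
  have sumf' A t : \sum_v f A t v *: point R v = \sum_(v in A) t v *: point R v.
    rewrite [RHS]big_mkcond; apply: eq_bigr => v _; rewrite /f.
    by case: ifP => // _; rewrite scale0r.
  pose c v := f X.1 a v - f X.2 b v.
  have dc : affine_dep c.
    apply/affine_depE; split; first by rewrite sumrB !sumf a1 b1 subrr.
    under eq_bigr do rewrite scalerBl.
    by rewrite sumrB !sumf' -ap -bp subrr.
  have cX : csupp c \subset supp X.
    apply/subsetP=> v; rewrite !inE /c /f; apply: contraR.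
    by rewrite negb_or => /andP[/negbTE -> /negbTE ->]; rewrite subrr.
  have [v cv] : exists v, c v != 0.
    apply/not_existsP=> h.
    suff: \sum_(v in X.1) a v = 0 by rewrite a1 => /eqP; rewrite oner_eq0.
    rewrite big1 // => v vX; have /negP/negPn/eqP := h v.
    by rewrite /c /f vX (disjointFr dX vX) subr0.
  (* A nonzero dependency on a circuit vanishes nowhere on it, since the circuit minus a vertex is
     independent. All the convex weights are therefore strictly positive. *)
  have cE : csupp c = supp X.
    apply/eqP; rewrite eqEsubset cX /=; apply/subsetP=> u uX.
    rewrite inE; apply: contra cv => /eqP cu; apply/eqP.
    have /cube_indepP := circuit_del CX uX; apply=> //.
    by rewrite subsetD1 cX inE cu eqxx.
  exists c => //; rewrite [X]surjective_pairing; congr pair; apply/setP=> u.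
    have := congr1 (fun A : {set vertex n} => u \in A) cE; rewrite !inE /c /f.
    case: (boolP (u \in X.1)) => u1.
      by rewrite (disjointFr dX u1) subr0 /= lt0r a0 // andbT => ->.
    rewrite sub0r oppr_gt0 => _; case: ifP => u2; last by rewrite ltxx.
    by apply/esym/negbTE; rewrite -leNgt b0.
  have := congr1 (fun A : {set vertex n} => u \in A) cE; rewrite !inE /c /f.
  case: (boolP (u \in X.1)) => u1.
    rewrite (disjointFr dX u1) subr0 => _.
    by apply/esym/negbTE; rewrite -leNgt a0.
  rewrite sub0r oppr_lt0; case: (boolP (u \in X.2)) => u2; last by rewrite ltxx.
  by rewrite oppr_eq0 lt0r b0 // andbT => ->.
move=> [CX [c dc E]]; apply/and3P; split=> //.
  rewrite E /sdisjoint disjoints_subset; apply/subsetP=> u.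
  by rewrite !inE -leNgt => /ltW.
have [c0 _] := dc; have [_ c1] := (affine_depE c).1 dc.
have cX : csupp c = supp X by rewrite E supp_dep_signs.
have split_sum (V : lmodType R) (f : vertex n -> V) : \sum_v c v *: f v =
    \sum_(v in X.1) c v *: f v - \sum_(v in X.2) (- c v) *: f v.
  rewrite -sumrN (bigID (mem X.1)) /=; congr (_ + _).
  rewrite big_mkcond [RHS]big_mkcond; apply: eq_bigr => v _.
  rewrite E !inE scaleNr opprK -leNgt le_eqVlt.
  by have [->|] := eqVneq (c v) 0; rewrite ?scale0r ?if_same // ltxx.
have split_sum1 : \sum_(v in X.1) c v = \sum_(v in X.2) - c v.
  have := split_sum (GRing.regular R) (fun=> 1).
  have E1 (r : R) : r *: (1 : GRing.regular R) = r by rewrite /GRing.scale /= mulr1.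
  under eq_bigr do rewrite E1; rewrite c0.
  under eq_bigr do rewrite E1.
  under [X in _ - X]eq_bigr do rewrite E1.
  by move/esym/eqP; rewrite subr_eq0 => /eqP.
have /set0Pn[v vX] : supp X != set0.
  exact: circuit_neq0 CX.
have ge1 u : u \in X.1 -> 0 <= c u by rewrite E inE => /ltW.
have ge2 u : u \in X.2 -> 0 <= - c u by rewrite E inE oppr_ge0 => /ltW.
pose s := \sum_(v in X.1) c v.
have s0 : 0 < s.
  move: vX; rewrite inE => /orP[vX|vX].
    rewrite /s (bigD1 v) //= ltr_wpDr //; last by move: vX; rewrite E inE.
    by apply: sumr_ge0 => u /andP[/ge1].
  rewrite /s split_sum1 (bigD1 v) //= ltr_wpDr //; last by move: vX; rewrite E inE oppr_gt0.
  by apply: sumr_ge0 => u /andP[/ge2].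
apply/asboolP; exists (s^-1 *: \sum_(v in X.1) c v *: point R v); split.
  exists (fun v => s^-1 * c v); split=> [u /ge1 cu||].
  - by rewrite mulr_ge0 // invr_ge0 ltW.
  - by rewrite -mulr_sumr mulVf // gt_eqF.
  - by rewrite scaler_sumr; apply: eq_bigr => u _; rewrite scalerA.
exists (fun v => s^-1 * - c v); split=> [u /ge2 cu||].
- by rewrite mulr_ge0 // invr_ge0 ltW.
- by rewrite -mulr_sumr -split_sum1 mulVf // gt_eqF.
- have := split_sum _ (@point R n); rewrite c1 => /esym/eqP; rewrite subr_eq0 => /eqP ->.
  by rewrite scaler_sumr; apply: eq_bigr => u _; rewrite scalerA.
Qed.

(** By induction on the size of the support: if the support of [h] is not a circuit, subtract a
    multiple of the dependency of a circuit inside it, so that a vertex leaves the support and no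
    sign is reversed. *)
Lemma conformal_circuit h : affine_dep h -> (exists v, h v != 0) ->
  exists g, [/\ affine_dep g, csupp g \in circuits N,
    (dep_signs g).1 \subset (dep_signs h).1 &
    (dep_signs g).2 \subset (dep_signs h).2].
Proof.
have [m] := ubnP #|csupp h|; elim: m h => // m IH h hm dh [v hv].
have [Ch|nCh] := boolP (csupp h \in circuits N); first by exists h.
have hN : csupp h \notin N.
  apply/negP => /cube_indepP/(_ _ dh (subxx _) v) E.
  by rewrite E eqxx in hv.
have [C CC Ch] := circuit_in hN; have [g0 dg0 gC0] := circuit_dep CC.
(* This vertex outside the circuit keeps its weight, so that the reduced dependency stays
   nonzero. *)
have [j jh jC] : exists2 j, j \in csupp h & j \notin C.
  by apply/subsetPn; apply: contra nCh => hC; rewrite (_ : csupp h = C) //;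
     apply/eqP; rewrite eqEsubset hC.
have [i iC] : exists i, i \in C.
  apply/set0Pn; exact: circuit_neq0 CC.
have [g [dg gC ig]] : exists g, [/\ affine_dep g, csupp g = C & 0 < h i * g i].
  have gi : g0 i != 0 by have := iC; rewrite -gC0 inE.
  have hi : h i != 0 by have := subsetP Ch _ iC; rewrite inE.
  have := mulf_neq0 hi gi; rewrite neq_lt => /orP[lt0|]; last by exists g0.
  exists (fun u => - g0 u); split; first exact: affine_depN.
    by rewrite -gC0; apply/setP=> u; rewrite !inE oppr_eq0.
  by rewrite mulrN oppr_gt0.
(* The least ratio among the vertices where [h] and [g] have the same sign is the largest multiple
   of [g] that can be subtracted without reversing a sign; the weight at [k] becomes zero. *)
have [k kg kmin] := @Order.TotalTheory.arg_minP _ _ _ i (fun u => 0 < h u * g u)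
  (fun u => h u / g u) ig.
pose l := h k / g k.
have gk : g k != 0 by apply: contraTneq kg => ->; rewrite mulr0 ltxx.
have l0 : 0 < l.
  have g2 : 0 < g k ^+ 2 by rewrite exprn_even_gt0.
  by rewrite -(pmulr_lgt0 _ g2) /l expr2 mulrA divfK.
pose h' u := 1 * h u + (- l) * g u.
have dh' : affine_dep h' by apply: affine_dep_lin.
have out u : h u = 0 -> g u = 0.
  move=> hu; apply/eqP; have := subsetP Ch u.
  by rewrite -gC !inE hu eqxx; case: (g u == 0) => // /(_ isT).
have le u : 0 < h u * g u -> l <= h u / g u by apply: kmin.
have h'h : csupp h' \subset csupp h :\ k.
  rewrite subsetD1 !inE negbK; apply/andP; split.
    apply/subsetP=> u; rewrite !inE; apply: contra => /eqP hu.
    by rewrite /h' hu (out _ hu) !mulr0 addr0.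
  by rewrite /h' /l mul1r mulNr divfK // subrr.
have kh : k \in csupp h by rewrite inE; apply: contraTneq kg => ->; rewrite mul0r ltxx.
have [|//||g' [dg' Cg' g1 g2]] := IH h'.
- by apply: leq_ltn_trans (subset_leq_card h'h) _; move: hm; rewrite (cardsD1 k) kh.
- exists j; rewrite /h'; have -> : g j = 0.
    by apply/eqP/negPn; move: jC; rewrite -gC inE.
  by rewrite mulr0 addr0 mul1r; move: jh; rewrite inE.
exists g'; split=> //.
  apply: subset_trans g1 _; apply/subsetP=> u; rewrite !inE /h' => h1.
  have [|hu|hu] := ltrgtP (h u) 0; last 1 first.
  - by move: h1; rewrite hu (out _ hu) !mulr0 addr0 ltxx.
  - move=> hu; have [gu|gu] := leP 0 (g u).
      by have := mulr_ge0 (ltW l0) gu; lra.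
    have : l <= h u / g u by apply: le; rewrite nmulr_rgt0.
    by rewrite ler_ndivlMr //; lra.
  by [].
apply: subset_trans g2 _; apply/subsetP=> u; rewrite !inE /h' => h1.
have [//|hu|hu] := ltrgtP (h u) 0; last first.
  by move: h1; rewrite hu (out _ hu) !mulr0 addr0 ltxx.
have [gu|gu] := leP (g u) 0.
  by have := mulr_ge0_le0 (ltW l0) gu; lra.
have : l <= h u / g u by apply: le; rewrite mulr_gt0.
by rewrite ler_pdivlMr //; lra.
Qed.

(** Incomparability holds because dependencies of the same circuit are proportional. For
    elimination, a positive combination of the two dependencies vanishes at [e], and a conformal
    circuit of it is the required one. *)
Lemma aff_cube_om : oriented_matroid (aff_cube R n).
Proof.
split.
- by move=> X; rewrite inE => /and3P[].
- move=> X /aff_cubeP[CX _]; exact: circuit_neq0 CX.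
- move=> X /aff_cubeP[CX [c dc E]]; apply/aff_cubeP; rewrite supp_sopp; split=> //.
  by exists (fun u => - c u); [exact: affine_depN | rewrite dep_signsN E].
- move=> X Y /aff_cubeP[CX [c dc EX]] /aff_cubeP[CY [d dd EY]] XY.
  have EXY := circuit_sub CX CY XY.
  have cE : csupp c = supp Y by rewrite -EXY EX supp_dep_signs.
  have dE : csupp d = supp Y by rewrite EY supp_dep_signs.
  have [v vY] : exists v, v \in supp Y.
    by apply/set0Pn; exact: circuit_neq0 CY.
  have cv : c v != 0 by have := vY; rewrite -cE inE.
  have dv : d v != 0 by have := vY; rewrite -dE inE.
  have h : forall u, c u = c v / d v * d u.
    move=> u; apply: (mulfI dv).
    rewrite (affine_dep_eq (circuit_del CY vY) dc dd) ?cE ?dE //.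
    by rewrite mulrA mulrCA divff // mulr1.
  have : c v / d v != 0 by rewrite mulf_neq0 ?invr_eq0.
  rewrite neq_lt => /orP[r0|r0]; last by left; rewrite EX EY (dep_signs_scale r0 h).
  right; rewrite EX EY -dep_signsN; apply: (@dep_signs_scale _ _ (- (c v / d v))).
    by rewrite oppr_gt0.
  by move=> u; rewrite h mulrNN.
move=> X Y e /aff_cubeP[CX [c dc EX]] /aff_cubeP[CY [d dd EY]] nXY.
rewrite EX EY !inE => /andP[ce de].
(* Both coefficients are positive, as [c e] is positive and [d e] negative. *)
pose h u := (- d e) * c u + c e * d u.
have dh : affine_dep h by apply: affine_dep_lin.
(* If [h] were zero, [c] would be a negative multiple of [d] and [X] would be [sopp Y]. *)
have [u hu] : exists u, h u != 0.
  apply/not_existsP => h0; apply: nXY; rewrite EX EY -dep_signsN.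
  apply: (@dep_signs_scale _ _ (- (c e / d e))).
    by rewrite oppr_gt0 pmulr_rlt0 // invr_lt0.
  move=> u; have /negP/negPn/eqP := h0 u; rewrite /h => E.
  rewrite mulrNN; apply: (mulfI (ltr0_neq0 de)).
  by rewrite mulrA mulrCA divff ?ltr0_neq0 // mulr1; lra.
have [|g [dg Cg g1 g2]] := conformal_circuit dh; first by exists u.
exists (dep_signs g); split.
- apply/aff_cubeP; split; first by rewrite supp_dep_signs.
  by exists g.
- apply: subset_trans g1 _; apply/subsetP=> t; rewrite !inE => ht.
  apply/andP; split.
    by apply: contraTneq ht => ->; rewrite /h mulNr mulrC addNr ltxx.
  apply: contraTT ht; rewrite negb_or -!leNgt => /andP[h1 h2].
  by rewrite /h; have := mulr_ge0_le0 (ltW ce) h2; have := mulr_le0 (ltW de) h1; lra.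
- apply: subset_trans g2 _; apply/subsetP=> t; rewrite !inE => ht.
  apply/andP; split.
    by apply: contraTneq ht => ->; rewrite /h mulNr mulrC addNr ltxx.
  apply: contraTT ht; rewrite negb_or -!leNgt => /andP[h1 h2].
  by rewrite /h; have := mulr_ge0 (ltW ce) h2; have := mulr_le0_ge0 (ltW de) h1; lra.
Qed.

Lemma aff_cube_orientation : orientation N (aff_cube R n).
Proof.
split; first exact: aff_cube_om.
apply/setP=> A; rewrite [LHS]inE; apply/forallP/idP => [hA|AN X].
  apply/negPn/negP => AN; have [C CC CA] := circuit_in AN.
  have [c dc cC] := circuit_dep CC.
  have /implyP := hA (dep_signs c); rewrite supp_dep_signs cC CA => /(_ _)/negP; apply=> //.
  by apply/aff_cubeP; rewrite supp_dep_signs cC; split=> //; exists c.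
apply/implyP => /aff_cubeP[/circuit_notin CX _]; apply: contra CX => XA.
exact: cube_indep_sub XA AN.
Qed.

Lemma rectangle_aff v I J : I != set0 -> J != set0 -> [disjoint I & J] ->
  rectangle v I J \in aff_cube R n.
Proof.
move=> I0 J0 dIJ; have dQ := rectangle_sdisjoint v I0 J0 dIJ.
apply/aff_cubeP; split; first exact: rectangle_circuit.
exists (rectangle_weight R v I J); first exact: rectangle_weight_dep.
congr pair; apply/setP=> u; rewrite !inE /rectangle_weight;
  have := disjointFr dQ (x := u); rewrite /= !in_set2;
  do 4!case: (u == _) => //=; do ?[by move=> /(_ isT)]; move=> _; lra.
Qed.

End AffineOrientation.

(** * Facets *)

Section FacetBases.
Variables (R : realType) (n : nat).
Implicit Types (c d : vertex n -> R) (A B C F : {set vertex n}).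
Implicit Types (u v w x y z : vertex n) (I J : {set 'I_n}).

Notation N := (cube_matroid R n).

Definition is_basis F B : Prop :=
  [/\ B \subset F, B \in N & forall x, x \in F -> x \notin B -> x |: B \notin N].

Lemma basis_exists A F : A \in N -> A \subset F ->
  exists2 B, is_basis F B & A \subset B.
Proof.
move=> AN AF; pose P := [pred B : {set vertex n} | (B \in N) && (B \subset F)].
have [|B /maxsetP[/andP[BN BF] Bmax] AB] := @maxset_exists _ P A.
  by rewrite /= AN AF.
exists B => //; split=> // x xF xB; apply: contra xB => xBN.
rewrite -(Bmax (x |: B)) ?setU11 ?subsetUr //=.
by rewrite xBN subUset sub1set xF BF.
Qed.

(** The dependency [d] is unique on [x |: B] up to a factor. One that vanishes at [b] must vanish at
    [x] too, hence lies on [B] and is zero; this gives independence. *)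
Lemma basis_exchange F B x d b : is_basis F B -> x \in F -> x \notin B ->
  affine_dep d -> csupp d \subset x |: B -> b \in B -> d b != 0%R ->
  is_basis F (x |: (B :\ b)).
Proof.
move=> [BF BN Bs] xF xB dd dB bB db.
have BxN : (x |: B) :\ x \in N by rewrite setU1K.
have bx : b != x by apply: contra xB => /eqP <-.
have sub : x |: B :\ b \subset x |: B by rewrite setUS // subsetDl.
split.
- by rewrite subUset sub1set xF; apply: subset_trans BF; apply: subsetDl.
- apply/cube_indepP=> c dc cB; have cB' := subset_trans cB sub.
  have cb : c b = 0%R.
    apply/eqP; have := subsetP cB b; rewrite !inE eqxx /= orbF (negbTE bx).
    by case: (c b == _) => // /(_ isT).
  have := affine_dep_eq BxN dc dd cB' dB b.
  rewrite cb mulr0 => /esym/eqP; rewrite mulf_eq0 (negbTE db) orbF => /eqP cx.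
  have /cube_indepP := BN; apply=> //; apply: subset_trans (subsetDl B [set b]).
  apply/subsetP=> u uc; have := subsetP cB _ uc; rewrite in_setU1.
  by case/orP=> // /eqP E; move: uc; rewrite E inE cx eqxx.
move=> y yF; rewrite in_setU1 in_setD1 negb_or negb_and negbK => /andP[yx /orP[/eqP ->|yB]].
  apply/negP => /cube_indepP/(_ _ dd)/(_ _ b) E; move/eqP: db; apply; apply: E.
  by rewrite setUCA setD1K.
have yb : y != b by apply: contra yB => /eqP ->.
have [c [dc cB [t ct]]] := cube_dep (Bs _ yF yB).
have cy : c y != 0%R.
  apply: contra ct => /eqP cy; apply/eqP; have /cube_indepP := BN; apply=> //.
  apply/subsetP=> u uc; have := subsetP cB _ uc; rewrite in_setU1.
  by case/orP=> // /eqP E; move: uc; rewrite E inE cy eqxx.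
(* For maximality, [b] is eliminated between the dependency [c] of [y] on [B] and [d]; the result is
   nonzero at [y], where [d] vanishes. *)
have dy : d y = 0%R.
  apply/eqP; have := subsetP dB y; rewrite !inE (negbTE yx) (negbTE yB).
  by case: (d y == _) => // /(_ isT).
apply/negP => /cube_indepP/(_ _ (affine_dep_lin (d b) (- c b)%R dc dd)) E.
have /eqP := mulf_neq0 db cy; apply.
suff S : csupp (fun u => (d b * c u + - c b * d u)%R) \subset y |: (x |: B :\ b).
  by have := E S y; rewrite dy mulr0 addr0.
apply/subsetP=> u; rewrite !inE; apply: contraR; rewrite !negb_or negb_and negbK.
move=> /and3P[uy ux uB].
have [->|ub] := eqVneq u b; first by rewrite mulNr mulrC subrr.
rewrite (negbTE ub) /= in uB.
have out (e : vertex n -> R) z : csupp e \subset z |: B -> u != z -> e u = 0%R.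
  move=> eB uz; apply/eqP; have := subsetP eB u; rewrite !inE (negbTE uz) (negbTE uB).
  by case: (e u == _) => // /(_ isT).
by rewrite (out _ _ cB uy) (out _ _ dB ux) !mulr0 addr0.
Qed.

(** The function [a] gives the coefficients of [x] as an affine combination of [B]: the dependency
    of [x] on [B] is scaled to have weight 1 at [x], where it is nonzero because [B] is
    independent. *)
Lemma basis_combination F B x : is_basis F B -> x \in F ->
  exists2 a : vertex n -> R, csupp a \subset B &
    affine_dep (fun u => (u == x)%:R - a u)%R.
Proof.
move=> [BF BN Bs] xF; case: (boolP (x \in B)) => xB.
  exists (fun u => (u == x)%:R)%R.
    apply/subsetP=> u; rewrite inE; case: (u =P x) => [->//|_]; by rewrite eqxx.
  by split=> [|i]; rewrite big1 // => u _; rewrite subrr.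
have [c [dc cB [t ct]]] := cube_dep (Bs _ xF xB).
have cx : c x != 0%R.
  apply: contra ct => /eqP cx; apply/eqP; have /cube_indepP := BN; apply=> //.
  apply/subsetP=> u uc; have := subsetP cB _ uc; rewrite in_setU1.
  by case/orP=> // /eqP E; move: uc; rewrite E inE cx eqxx.
exists (fun u => (u == x)%:R - (c x)^-1 * c u)%R.
  apply/subsetP=> u; rewrite inE; case: (u =P x) => [->|/eqP ux].
    by rewrite mulVf // subrr eqxx.
  rewrite sub0r oppr_eq0 mulf_eq0 negb_or => /andP[_ cu].
  by have := subsetP cB u; rewrite !inE cu (negbTE ux); apply.
have := affine_dep_lin (c x)^-1 0 dc dc; congr affine_dep.
by apply/funext => u; rewrite mul0r addr0 subKr.
Qed.

Definition diff u v : {set 'I_n} := [set i | u i != v i].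

Lemma flip_diff u v : flip (diff u v) u = v.
Proof. by apply/ffunP=> i; rewrite flipE inE; case: (u i) (v i) => [] []. Qed.

Lemma diff_neq0 u v : u != v -> diff u v != set0.
Proof.
apply: contra => /eqP E; rewrite -[v](flip_diff u v) E; apply/eqP/ffunP=> i.
by rewrite flipE inE addbF.
Qed.

Variables (eps : bool) (i : 'I_n).
Notation H := (facet eps i).
Notation opp v := (flip [set i] v).

Lemma facet_opp v : v \in H -> opp v \in ~: H.
Proof. by rewrite !inE flipE !inE eqxx => /eqP ->; case: eps. Qed.

Lemma facet_diff v w : v \in H -> w \in H -> [disjoint [set i] & diff v w].
Proof. by rewrite !inE => /eqP vi /eqP wi; rewrite disjoints1 inE vi wi eqxx. Qed.

(** The vertex [w] is alone in the facet [H], so its weight is zero in every dependency. *)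
Lemma indep_facet B w : B \in N -> B \subset ~: H -> w \in H -> w |: B \in N.
Proof.
move=> BN BH wH; apply/cube_indepP=> c dc cB.
have cw : c w = 0%R.
  apply: (affine_dep_single (i := i) dc) => u e uw; apply/eqP/negPn/negP => cu.
  have := subsetP cB u; rewrite inE cu in_setU1 (negbTE uw) => /(_ isT) /(subsetP BH).
  by move: wH; rewrite !inE e => ->.
have /cube_indepP := BN; apply=> //; apply/subsetP=> u uc.
have := subsetP cB _ uc; rewrite in_setU1 => /orP[/eqP E|//].
by move: uc; rewrite E inE cw eqxx.
Qed.

(** A circuit meeting [H] in [w] meets it again, and [v] is the only other candidate. This supplies
    the hypothesis of [pair_sgn] that circuits contain both or neither of [v] and [w]. *)
Lemma circuit_facet C B v w : C \in circuits N -> B \subset ~: H ->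
  v \in H -> w \in H -> C \subset B :|: [set v; w] -> w \in C -> v \in C.
Proof.
move=> CC BH vH wH CB wC; have [u [uC uw e]] := circuit_single i CC wC.
have := subsetP CB _ uC; rewrite in_setU in_set2 (negbTE uw) orbF.
case/orP=> [/(subsetP BH)|/eqP <- //].
by move: wH; rewrite !inE e => ->.
Qed.

Lemma circuit_facet_uniq C D B v w : C \in circuits N -> D \in circuits N ->
  B \in N -> B \subset ~: H -> v \in H -> w \in H ->
  C \subset B :|: [set v; w] -> D \subset B :|: [set v; w] -> C = D.
Proof.
move=> CC DC BN BH vH wH; apply: circuit_uniq CC DC.
have sub : (B :|: [set v; w]) :\ v \subset w |: B.
  by apply/subsetP=> u; rewrite !inE; case: (u == v) => //=; rewrite orbC.
exact: cube_indep_sub sub (indep_facet BN BH wH).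
Qed.

(** The difference of [v] and [w] equals that of their neighbours across the direction [i], and
    these are affine combinations of [B]. *)
Lemma facet_pair_dep B v w : is_basis (~: H) B -> v \in H -> w \in H -> v != w ->
  B :|: [set v; w] \notin N.
Proof.
move=> Bb vH wH vw; have [BH BN _] := Bb.
have [a aB da] := basis_combination Bb (facet_opp vH).
have [b bB db] := basis_combination Bb (facet_opp wH).
have J0 := diff_neq0 vw; have dIJ := facet_diff vH wH.
have dq := rectangle_weight_dep R v dIJ.
(* The neighbours of [v] and [w] cancel; [v] and [w] keep the weights 1 and -1, and all other
   weights lie on [B]. *)
have dc := affine_dep_lin 1 1 dq (affine_dep_lin 1 (-1)%R da db).
apply/negP => /cube_indepP/(_ _ dc).
have E : flip ([set i] :|: diff v w) v = opp w.
  by apply/ffunP=> j; rewrite -{2}(flip_diff v w) !flipE in_setU;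
    have := disjointFr dIJ (x := j); case: (j \in [set i]) => [-> //|_];
    rewrite ?addbF ?orbF.
rewrite /rectangle_weight E flip_diff.
have out (e : vertex n -> R) u : csupp e \subset B -> u \notin B -> e u = 0%R.
  by move=> eB uB; apply/eqP; have := subsetP eB u; rewrite !inE (negbTE uB);
    case: (e u == _) => // /(_ isT).
move=> /(_ _ v) h; have vB : v \notin B.
  by apply/negP => /(subsetP BH); rewrite inE vH.
have ne u u' : u \in H -> u' \in ~: H -> (u == u') = false.
  by move=> uH; rewrite in_setC => u'H; apply: contraNF u'H => /eqP <-.
have : (0 : R)%R <> 1%R by apply/eqP; rewrite eq_sym oner_eq0.
apply; rewrite -[LHS]h.
  rewrite (out _ _ aB vB) (out _ _ bB vB) eqxx (negbTE vw).
  rewrite (ne v (opp w)) ?facet_opp // (ne v (opp v)) ?facet_opp // /=; ring.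
apply/subsetP=> u; rewrite !inE; apply: contraR; rewrite !negb_or.
move=> /and3P[uB /negbTE -> /negbTE ->].
by rewrite (out _ _ aB uB) (out _ _ bB uB); apply/eqP; ring.
Qed.

(** Cocircuits are the minimal sets meeting every basis. A basis cannot avoid [H], since adding a
    vertex of [H] would keep it independent. If [v] in [H] is left out, adding [v] to a basis of the
    opposite facet gives a basis missing the rest of [H]. *)
Lemma facet_cocircuit : H \in cocircuits N.
Proof.
have [w wH] : exists w, w \in H by exists [ffun=> eps]; rewrite inE ffunE.
rewrite inE; apply/minsetP; split=> [|D].
  rewrite !inE; apply/existsP => -[B /andP[]].
  rewrite inE => /maxsetP[BN Bmax] HB.
  have BH : B \subset ~: H by rewrite -[B]setCK setCS.
  have : w \in B by rewrite -(Bmax _ (indep_facet BN BH wH)) ?setU11 ?subsetUr.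
  by apply/negP; rewrite -in_setC (subsetP HB).
rewrite !inE => Ddual DH; apply/eqP; rewrite eqEsubset DH /=.
apply/subsetP=> v vH; apply: contraR Ddual => vD.
have [|B Bb _] := basis_exists (A := set0) (F := ~: H) _ (sub0set _).
  exact: cube_indep_sub (sub0set _) (cube_indep3 R w w w).
have [BH BN Bs] := Bb.
apply/existsP; exists (v |: B); apply/andP; split; last first.
  apply/subsetP=> u uD; rewrite !inE negb_or.
  rewrite (contraTneq _ uD) /= => [|->//].
  by apply/negP => /(subsetP BH); rewrite inE (subsetP DH).
rewrite inE; apply/maxsetP; split=> [|A AN BA]; first exact: indep_facet.
apply/eqP; rewrite eqEsubset BA andbT; apply/subsetP=> u uA.
have vA : v \in A by rewrite (subsetP BA) ?setU11.
have BA' : B \subset A by apply: subset_trans BA; apply: subsetUr.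
rewrite in_setU1; apply/negPn/negP; rewrite negb_or => /andP[uv uB].
case: (boolP (u \in H)) => uH.
  have vu : v != u by rewrite eq_sym.
  have /negP := facet_pair_dep Bb vH uH vu; apply.
  by apply: cube_indep_sub AN; rewrite !subUset BA' !sub1set vA.
rewrite -in_setC in uH; have /negP := Bs u uH uB; apply.
by apply: cube_indep_sub AN; rewrite subUset BA' sub1set uA.
Qed.

(** * Signs on a facet in an orientation containing the rectangles *)

Variable M : {set signed_set (vertex n)}.
Hypotheses (orM : orientation N M) (MR : rectangle_family n \subset M).

Let omM : oriented_matroid M := proj1 orM.

Lemma orientation_circuit X : X \in M -> supp X \in circuits N.
Proof. by move=> XM; rewrite -(proj2 orM); apply: om_circuit. Qed.

Lemma orientation_exists C : C \in circuits N -> exists2 X, X \in M & supp X = C.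
Proof. by rewrite -(proj2 orM); apply: circuit_om. Qed.

Lemma orientation_in A : A \notin N -> exists2 X, X \in M & supp X \subset A.
Proof. by rewrite -(proj2 orM); apply: dependent_om. Qed.

(** When [B] is a basis of the opposite facet and [v], [w] are distinct vertices of [H], the
    quantifier ranges over a single circuit and its negative. *)
Definition opposite_signs v w B : Prop :=
  forall Y, Y \in M -> supp Y \subset B :|: [set v; w] -> sgn Y v != sgn Y w.

Lemma circuit_facet_pair Y B v w : Y \in M -> B \in N -> B \subset ~: H ->
  v \in H -> w \in H -> supp Y \subset B :|: [set v; w] ->
  v \in supp Y /\ w \in supp Y.
Proof.
move=> YM BN BH vH wH YB; have CY := orientation_circuit YM.
have YB' : supp Y \subset B :|: [set w; v] by rewrite [[set w; v]]setUC.
have h1 := circuit_facet CY BH vH wH YB.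
have h2 := circuit_facet CY BH wH vH YB'.
suff: (v \in supp Y) || (w \in supp Y) by case/orP=> h; split; auto.
apply: contraR (circuit_notin CY); rewrite negb_or => /andP[vY wY].
apply: cube_indep_sub BN; apply/subsetP=> u uY; have := subsetP YB _ uY.
rewrite in_setU in_set2 => /or3P[//|/eqP E|/eqP E].
  by rewrite -E uY in vY.
by rewrite -E uY in wY.
Qed.

(** The unique circuit is here a rectangle with [v] and [w] as an edge, whose signs are prescribed
    by [MR]. *)
Lemma opposite_signs_rectangle v w B : is_basis (~: H) B -> v \in H -> w \in H ->
  v != w -> opp v \in B -> opp w \in B -> opposite_signs v w B.
Proof.
move=> [BH BN _] vH wH vw vB wB Y YM YB.
have [vY wY] := circuit_facet_pair YM BN BH vH wH YB.
have J0 := diff_neq0 vw; have dIJ := facet_diff vH wH.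
have i0 : [set i] != set0 by apply/set0Pn; exists i; rewrite inE.
set Q := rectangle v [set i] (diff v w).
have QM : Q \in M.
  apply: (subsetP MR); rewrite inE; apply/existsP; exists v; apply/existsP.
  exists [set i]; apply/existsP; exists (diff v w).
  by rewrite i0 J0 dIJ eqxx.
have E : flip ([set i] :|: diff v w) v = opp w.
  by apply/ffunP=> j; rewrite -{2}(flip_diff v w) !flipE in_setU;
    have := disjointFr dIJ (x := j); case: (j \in [set i]) => [-> //|_];
    rewrite ?addbF ?orbF.
have QB : supp Q \subset B :|: [set v; w].
  rewrite supp_rectangle E flip_diff; apply/subsetP=> u; rewrite !inE -!orbA.
  by case/or4P=> /eqP ->; rewrite ?vB ?wB ?eqxx ?orbT.
have e := circuit_facet_uniq (orientation_circuit YM) (orientation_circuit QM)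
  BN BH vH wH YB QB.
have := supp_eq_sgn omM YM QM e vY wY; rewrite /sgn /= !in_set2 flip_diff eqxx orbT.
rewrite (negbTE vw) orbF eq_sym (negbTE (flip_neq v i0)).
by rewrite -addbT -addbA; case: (v \in Y.2) (w \in Y.2) => [] [].
Qed.

(** The circuits of the two bases are compared by [pair_sgn] inside [x |: B] with [v] and [w] added.
    If [Y] misses [b], it already lies over the exchanged basis. *)
Lemma opposite_signs_exchange v w B x d b : is_basis (~: H) B ->
  v \in H -> w \in H -> v != w ->
  x \in ~: H -> x \notin B -> affine_dep d -> csupp d \subset x |: B ->
  b \in B -> d b != 0%R ->
  opposite_signs v w (x |: B :\ b) -> opposite_signs v w B.
Proof.
move=> Bb vH wH vw xH xB dd dB bB db good Y YM YB.
have B1b := basis_exchange Bb xH xB dd dB bB db.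
have [[BH BN _] [B1H B1N _]] := (Bb, B1b).
have [vY wY] := circuit_facet_pair YM BN BH vH wH YB.
have neH u u' : u \in H -> u' \in ~: H -> (u' == u) = false.
  by move=> uH; rewrite in_setC => u'H; apply: contraNF u'H => /eqP ->.
have bH := subsetP BH _ bB.
have xb : (x == b) = false by apply: contraNF xB => /eqP ->.
case: (boolP (b \in supp Y)) => bY; last first.
  apply: good => //; apply/subsetP=> u uY; have := subsetP YB _ uY.
  have ub : u != b by apply: contraNneq bY => <-.
  by rewrite !inE ub /= => /orP[->|->]; rewrite ?orbT.
have [Y1 Y1M Y1B] := orientation_in (facet_pair_dep B1b vH wH vw).
have [vY1 wY1] := circuit_facet_pair Y1M B1N B1H vH wH Y1B.
have bY1 : b \notin supp Y1.
  apply/negP => /(subsetP Y1B).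
  by rewrite !inE eqxx eq_sym xb (neH v) // (neH w).
have xY : x \notin supp Y.
  by apply/negP => /(subsetP YB); rewrite in_setU in_set2 (negbTE xB) (neH v) // (neH w).
(* Otherwise [Y1] would lie over [B] and have the support of [Y], which contains [b]. *)
have xY1 : x \in supp Y1.
  apply/negPn/negP => xY1; have Y1B' : supp Y1 \subset B :|: [set v; w].
    apply/subsetP=> u uY; have := subsetP Y1B _ uY.
    have ux : (u == x) = false by apply: contraNF xY1 => /eqP <-.
    by rewrite !inE ux /= => /orP[/andP[_ ->]|->]; rewrite ?orbT.
  have e := circuit_facet_uniq (orientation_circuit YM) (orientation_circuit Y1M)
    BN BH vH wH YB Y1B'.
  by rewrite e (negbTE bY1) in bY.
have xBH : x |: B \subset ~: H by rewrite subUset sub1set xH.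
have e : sgn Y v (+) sgn Y w = sgn Y1 v (+) sgn Y1 w.
  (* Here [b] lies in [Y] only and [x] in [Y1] only. Each circuit inside [x |: B] contains both,
     because removing either leaves a basis. *)
  apply: (pair_sgn (F := x |: B) (x := b) (y := x) omM) => //.
  - by apply: subset_trans YB _; rewrite setSU // subsetUr.
  - apply: subset_trans Y1B _; rewrite setSU //.
    by rewrite subUset subsetUl (subset_trans (subsetDl _ _) (subsetUr _ _)).
  - move=> Z ZM ZB; have CZ := orientation_circuit ZM.
    have ZB' : supp Z \subset x |: B :|: [set w; v] by rewrite [[set w; v]]setUC.
    apply/idP/idP; [exact: circuit_facet ZB'|exact: circuit_facet ZB].
  - move=> Z ZM ZB; have CZ := circuit_notin (orientation_circuit ZM).
    apply/andP; split; apply: contraR CZ => uZ.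
      apply: cube_indep_sub B1N; apply/subsetP=> u uZ'; have := subsetP ZB _ uZ'.
      have ub : u != b by apply: contraNneq uZ => <-.
      by rewrite !inE ub.
    by apply: cube_indep_sub BN; rewrite -(setU1K xB) subsetD1 ZB.
  move=> Z W ZM WM ZB WB; have BxN : (x |: B) :\ x \in N by rewrite setU1K.
  exact: circuit_uniq BxN (orientation_circuit ZM) (orientation_circuit WM) ZB WB.
by have := good _ Y1M Y1B; move: e; do 4!case: (sgn _ _).
Qed.

(** At most two exchanges bring first [opp v] and then [opp w] into the basis, which reduces the
    claim to a rectangle. *)
Lemma opposite_signs_basis v w B : is_basis (~: H) B -> v \in H -> w \in H ->
  v != w -> opposite_signs v w B.
Proof.
move=> Bb vH wH vw.
have step2 B' : is_basis (~: H) B' -> opp v \in B' -> opposite_signs v w B'.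
  move=> Bb' vB'; have [BH BN Bs] := Bb'.
  case: (boolP (opp w \in B')) => wB'; first exact: opposite_signs_rectangle.
  have [d [dd dB [t dt]]] := cube_dep (Bs _ (facet_opp wH) wB').
  (* The second exchange must not remove [opp v]; another choice of [b] exists because [opp w] and
     [opp v] alone are independent. *)
  have [b [bB bv db]] : exists b, [/\ b \in B', b != opp v & d b != 0%R].
    apply/not_existsP => h; move/eqP: dt; apply.
    have /cube_indepP := cube_indep3 R (opp w) (opp v) (opp v); apply=> //.
    apply/subsetP=> u ud; have := subsetP dB _ ud; rewrite !inE.
    case/orP=> [->//|uB]; apply/negPn/negP; rewrite !negb_or => /andP[/andP[_ uv] _].
    by apply: (h u); split=> //; rewrite inE in ud.
  apply: (opposite_signs_exchange Bb' vH wH vw (facet_opp wH) wB' dd dB bB db).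
  apply: opposite_signs_rectangle => //; last by rewrite setU11.
    exact: basis_exchange (facet_opp wH) wB' dd dB bB db.
  by rewrite in_setU1 in_setD1 [_ == b]eq_sym bv vB' orbT.
have [BH BN Bs] := Bb.
case: (boolP (opp v \in B)) => vB; first exact: step2.
have [d [dd dB [t dt]]] := cube_dep (Bs _ (facet_opp vH) vB).
have [b [bB db]] : exists b, b \in B /\ d b != 0%R.
  apply/not_existsP => h; move/eqP: dt; apply.
  have /cube_indepP := cube_indep3 R (opp v) (opp v) (opp v); apply=> //.
  apply/subsetP=> u ud; have := subsetP dB _ ud; rewrite !inE.
  case/orP=> [->//|uB]; case: (h u); split=> //; by rewrite inE in ud.
apply: (opposite_signs_exchange Bb vH wH vw (facet_opp vH) vB dd dB bB db).
apply: step2; last by rewrite setU11.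
exact: basis_exchange (facet_opp vH) vB dd dB bB db.
Qed.

(** By induction on the number of vertices of [X] in [H]. If all of them had the same sign, an
    elimination against a circuit with opposite signs at [v] and [w] would give a circuit with fewer
    vertices in [H], again all of that sign. *)
Lemma facet_both_signs X x : X \in M -> x \in supp X -> x \in H ->
  exists y, [/\ y \in supp X, y \in H & sgn X y != sgn X x].
Proof.
have [m] := ubnP #|supp X :&: H|; elim: m X x => // m IH X v hm XM vX vH.
apply: contrapT => noy.
have same y : y \in supp X -> y \in H -> sgn X y = sgn X v.
  move=> yX yH; apply/eqP; apply: contraPT noy => ne; apply.
  by exists y.
have CX := orientation_circuit XM.
have [w [wX wv wi]] := circuit_single i CX vX.
have wH : w \in H by move: vH; rewrite !inE wi.
have XHN : supp X :\: H \in N.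
  apply: cube_indep_sub (circuit_del CX vX).
  apply/subsetP=> u; rewrite !in_setD in_set1 => /andP[uH ->]; rewrite andbT.
  by apply: contraNneq uH => ->.
have [|B Bb XB] := basis_exists (F := ~: H) XHN; first by rewrite setDE subsetIr.
have [BH BN _] := Bb; have vw : v != w by rewrite eq_sym.
(* Up to negation, [Y] disagrees with [X] at [v], which is eliminated, and then agrees with [X] at
   [w], the only other vertex of [Y] in [H]. *)
have [Y [YM YB nYv eYw]] : exists Y, [/\ Y \in M, supp Y \subset B :|: [set v; w],
    sgn X v != sgn Y v & sgn Y w = sgn X v].
  have [Y YM YB] := orientation_in (facet_pair_dep Bb vH wH vw).
  have := opposite_signs_basis Bb vH wH vw YM YB.
  have [vY wY] := circuit_facet_pair YM BN BH vH wH YB.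
  case: (boolP (sgn X v == sgn Y v)) => [/eqP e ne|ne1 ne2].
    exists (sopp Y); rewrite supp_sopp !(sgn_sopp omM YM) //; split=> //.
    - exact: om_symmetric.
    - by rewrite e; case: (sgn _ _).
    - by rewrite e; move: ne; do 2!case: (sgn _ _).
  by exists Y; split=> //; move: ne1 ne2; do 3!case: (sgn _ _).
have [vY wY] := circuit_facet_pair YM BN BH vH wH YB.
have nXY : supp X != supp Y.
  apply/eqP => e; have := supp_eq_sgn omM XM YM e vX wX.
  by rewrite eYw (same w) //; move: nYv; do 2!case: (sgn _ _).
have [Z [ZM vZ hZ]] := sgn_elimination omM XM YM nXY vX vY nYv.
have ZH u : u \in supp Z -> u \in H -> u \in supp X /\ sgn Z u = sgn X v.
  move=> uZ uH; have uv : u != v by apply: contraNneq vZ => <-.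
  case: (hZ _ uZ) => -[uX ->]; first by rewrite same.
  have := subsetP YB _ uX; rewrite in_setU in_set2 (negbTE uv).
  case/orP=> [/(subsetP BH)|/eqP ->]; last by [].
  by rewrite inE uH.
(* If [Z] missed [H], it would lie in the independent set [B]. *)
have [z zZ zH] : exists2 z, z \in supp Z & z \in H.
  apply: contrapT => noz; have /negP := circuit_notin (orientation_circuit ZM); apply.
  apply: cube_indep_sub BN; apply/subsetP=> u uZ.
  have uH : u \notin H by apply/negP => uH; apply: noz; exists u.
  case: (hZ _ uZ) => -[uX _]; first by apply: (subsetP XB); rewrite in_setD uH.
  have := subsetP YB _ uX; rewrite in_setU in_set2 => /or3P[//|/eqP E|/eqP E];
  by rewrite E ?vH ?wH in uH.
have [|y [yZ yH]] := IH Z z _ ZM zZ zH.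
  rewrite -ltnS; apply: leq_trans hm; rewrite ltnS; apply: proper_card.
  apply/properP; split.
    by apply/subsetP=> u; rewrite !in_setI => /andP[uZ uH]; rewrite uH (ZH u uZ uH).1.
  by exists v; rewrite !in_setI ?vX ?vH // (negbTE vZ).
by rewrite (ZH _ yZ yH).2 (ZH _ zZ zH).2 eqxx.
Qed.

End FacetBases.

Lemma sorthogonal_facet (T : finType) (X : signed_set T) (H : {set T}) :
  sorthogonal X (H, set0) = ((X.1 :&: H == set0) == (X.2 :&: H == set0)).
Proof.
by rewrite /sorthogonal /agreement /separation /= !setI0 setU0 set0U.
Qed.

Lemma sorthogonal_soppr (T : finType) (X Y : signed_set T) :
  sorthogonal X (sopp Y) = sorthogonal X Y.
Proof.
rewrite /sorthogonal /agreement /separation /= eq_sym.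
by [].
Qed.

Lemma facets_of_rectangles (R : realType) (n : nat) (M : {set signed_set (vertex n)}) :
  orientation (cube_matroid R n) M -> rectangle_family n \subset M ->
  facet_family n \subset signed_cocircuits M.
Proof.
move=> orM MR; have [omM uM] := orM; apply/subsetP=> Y.
rewrite inE => /existsP[eps /existsP[i hY]].
have E : [/\ sdisjoint Y, supp Y = facet eps i &
    forall X, sorthogonal X Y = sorthogonal X (facet eps i, set0)].
  case/orP: hY => /eqP ->; rewrite /sdisjoint /supp /= ?setU0 ?set0U.
    by rewrite disjoint_sym disjoints_subset sub0set.
  rewrite disjoints_subset sub0set; split=> // X.
  by rewrite -[(set0, _)]/(sopp (facet eps i, set0)) sorthogonal_soppr.
have [dY sY oY] := E.
rewrite inE dY sY uM facet_cocircuit /=; apply/forallP=> X; apply/implyP=> XM.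
rewrite oY sorthogonal_facet.
have both (x : vertex n) : x \in supp X -> x \in facet eps i ->
    (X.1 :&: facet eps i != set0) && (X.2 :&: facet eps i != set0).
  move=> xX xH; have [y [yX yH ne]] := facet_both_signs orM MR XM xX xH.
  apply/andP; split; apply/set0Pn.
    case: (boolP (sgn X x)) => sx.
      exists y; rewrite inE yH (sgn_fst omM XM) // andbT.
      by move: ne; rewrite sx; case: (sgn _ _).
    by exists x; rewrite inE xH (sgn_fst omM XM) // andbT.
  case: (boolP (sgn X x)) => sx; first by exists x; rewrite inE xH andbT.
  exists y; rewrite inE yH andbT -/(sgn X y).
  by move: ne; rewrite (negbTE sx); case: (sgn _ _).
case: (boolP (X.1 :&: _ == set0)) => [e1|/set0Pn[x]].
  case: (boolP (X.2 :&: _ == set0)) => // /set0Pn[x]; rewrite inE => /andP[x2 xH].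
  by have := both x; rewrite inE x2 orbT e1 => /(_ isT xH).
rewrite inE => /andP[x1 xH]; have := both x; rewrite inE x1 => /(_ isT xH)/andP[_].
by move=> /negbTE ->.
Qed.

(** * Reorientations and rectangles *)

Section Reorientation.
Variable T : finType.
Implicit Types (X Y : signed_set T) (A B : {set T}) (M : {set signed_set T}).

Lemma supp_sreorient A X : supp (sreorient A X) = supp X.
Proof.
by apply/setP=> u; rewrite !inE; case: (u \in A) (u \in X.1) (u \in X.2) => [] [] [].
Qed.

Lemma sreorient_sopp A X : sreorient A (sopp X) = sopp (sreorient A X).
Proof. by []. Qed.

Lemma sreorient_comp A B X :
  sreorient B (sreorient A X) = sreorient ((A :\: B) :|: (B :\: A)) X.
Proof.
by congr pair; apply/setP=> u; rewrite !inE;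
  case: (u \in A) (u \in B) (u \in X.1) (u \in X.2) => [] [] [] [].
Qed.

Lemma sreorientK A : involutive (sreorient A).
Proof.
move=> X; rewrite [RHS]surjective_pairing; congr pair; apply/setP=> u; rewrite !inE;
  by case: (u \in A) (u \in X.1) (u \in X.2) => [] [] [].
Qed.

Lemma mem_reorientation A M X : (X \in reorientation A M) = (sreorient A X \in M).
Proof. by rewrite -{1}[X](sreorientK A) mem_imset //; exact: inv_inj (@sreorientK A). Qed.

Lemma reorientation_comp A B M :
  reorientation B (reorientation A M) = reorientation ((A :\: B) :|: (B :\: A)) M.
Proof.
apply/setP=> X; rewrite !mem_reorientation sreorient_comp.
by rewrite [(A :\: B) :|: _]setUC.
Qed.

Lemma reorientationK A : involutive (reorientation (T := T) A).
Proof. by move=> M; apply/setP=> X; rewrite !mem_reorientation sreorientK. Qed.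

Lemma reorientation_om A M : oriented_matroid M -> oriented_matroid (reorientation A M).
Proof.
move=> omM; split.
- move=> X; rewrite mem_reorientation => /(om_disjoint omM); rewrite /sdisjoint.
  rewrite -!setI_eq0 => /eqP/setP E; apply/eqP/setP=> u; have := E u; rewrite !inE.
  by case: (u \in A) (u \in X.1) (u \in X.2) => [] [] [].
- by move=> X; rewrite mem_reorientation => /(om_nonempty omM); rewrite supp_sreorient.
- by move=> X; rewrite !mem_reorientation => /(om_symmetric omM).
- move=> X Y; rewrite !mem_reorientation => XM YM XY.
  have [|E|E] := om_incomparable omM XM YM; first by rewrite !supp_sreorient.
    by left; apply: inv_inj E; apply: sreorientK.
  by right; apply: (inv_inj (@sreorientK A)); rewrite E.
move=> X Y e; rewrite !mem_reorientation => XM YM nXY eXY.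
have nXY' : sreorient A X <> sopp (sreorient A Y).
  by rewrite -sreorient_sopp => /(inv_inj (@sreorientK A)).
have nYX' : sreorient A Y <> sopp (sreorient A X).
  by move=> E; apply: nXY'; rewrite E; case: (sreorient A X).
have fin Z : Z \in M ->
  Z.1 \subset ((sreorient A X).1 :|: (sreorient A Y).1) :\ e ->
  Z.2 \subset ((sreorient A X).2 :|: (sreorient A Y).2) :\ e ->
  exists Z, [/\ Z \in reorientation A M, Z.1 \subset (X.1 :|: Y.1) :\ e
                         & Z.2 \subset (X.2 :|: Y.2) :\ e].
  move=> ZM /subsetP Z1 /subsetP Z2; exists (sreorient A Z).
  rewrite mem_reorientation sreorientK; split=> //; apply/subsetP=> u;
    have := Z1 u; have := Z2 u; rewrite !inE; case: (u == e) => /=;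
    case: (u \in A) (u \in Z.1) (u \in Z.2) (u \in X.1) (u \in X.2) (u \in Y.1) (u \in Y.2)
      => [] [] [] [] [] [] [] //= h1 h2; by [have := h1 isT | have := h2 isT].
move: eXY; rewrite inE => /andP[eX eY]; case: (boolP (e \in A)) => eA.
  (* Reorientation changes the sign of [e] here, so the two circuits exchange roles. *)
  have [|Z [ZM Z1 Z2]] := om_elimination omM YM XM nYX' (e := e).
    by rewrite !inE eA eX eY !orbT.
  by apply: (fin Z) => //; rewrite setUC.
have [|Z [ZM Z1 Z2]] := om_elimination omM XM YM nXY' (e := e).
  by rewrite !inE eA eX eY.
exact: (fin Z).
Qed.

Lemma reorientation_orientation A M (N : {set {set T}}) :
  orientation N M -> orientation N (reorientation A M).
Proof.
move=> [omM <-]; split; first exact: reorientation_om.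
apply/setP=> B; rewrite !inE; apply/forallP/forallP => h X; apply/implyP => XM.
  have /implyP := h (sreorient A X); rewrite mem_reorientation sreorientK supp_sreorient.
  exact.
have /implyP := h (sreorient A X); rewrite supp_sreorient; apply.
by rewrite -mem_reorientation.
Qed.

End Reorientation.

(** * Reorientations of the affine orientation that keep the facets positive *)

Lemma aff_cube_facet_reorientation (R : realType) (n : nat) (A : {set vertex n}) :
  facet_family n \subset signed_cocircuits (reorientation A (aff_cube R n)) ->
  reorientation A (aff_cube R n) = aff_cube R n.
Proof.
move=> FA; have [omA _] := aff_cube_orientation R n.
have adj (u v : vertex n) (i : 'I_n) : u i = v i -> (u \in A) = (v \in A).
  move=> e; have [->//|uv] := eqVneq u v; have J0 := diff_neq0 uv.
  have i0 : [set i] != set0 by apply/set0Pn; exists i; rewrite inE.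
  have dIJ : [disjoint [set i] & diff u v] by rewrite disjoints1 inE e eqxx.
  have := rectangle_aff R u i0 J0 dIJ.
  have HF : (facet (u i) i, set0) \in facet_family n.
    by rewrite inE; apply/existsP; exists (u i); apply/existsP; exists i; rewrite eqxx.
  have := subsetP FA _ HF; rewrite inE => /and3P[_ _ /forallP orth] QM.
  have := orth (sreorient A (rectangle u [set i] (diff u v))).
  rewrite mem_reorientation sreorientK QM /= sorthogonal_facet => {orth}.
  have outI t : t \in facet (u i) i -> t != flip [set i] u.
    rewrite inE => /eqP ti; apply/eqP => /ffunP/(_ i).
    by rewrite flipE inE eqxx ti; case: (u i).
  have outIJ t : t \in facet (u i) i -> t != flip ([set i] :|: diff u v) u.
    rewrite inE => /eqP ti; apply/eqP => /ffunP/(_ i); rewrite flipE !inE eqxx ti.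
    by case: (u i).
  have uH : u \in facet (u i) i by rewrite inE.
  have vH : v \in facet (u i) i by rewrite inE e.
  (* The rectangle meets the facet exactly in [u] and [v], with opposite signs. Reversing only one
     of them leaves a single sign on the facet, against orthogonality. *)
  case: (boolP (u \in A)) => uA; case: (boolP (v \in A)) => vA //.
    set S1 := (X in (X == set0) == _); set S2 := (X in _ == (X == set0)).
    have -> : S1 = set0.
      apply/setP=> t; rewrite [RHS]inE in_setI; apply/negP => /andP[].
      rewrite !inE flip_diff => h tH; move: h; rewrite (negbTE (outI t _)) ?inE // (negbTE (outIJ t _)) ?inE //.
      rewrite orbF /=; case: (t =P u) => [->|_]; first by rewrite uA (negbTE uv).
      by case: (t =P v) => [->|_]; rewrite ?(negbTE vA) ?andbF.
    suff -> : (S2 == set0) = false by rewrite eqxx.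
    by apply/negbTE/set0Pn; exists u; rewrite !inE uA !eqxx !orbT.
  set S1 := (X in (X == set0) == _); set S2 := (X in _ == (X == set0)).
  have -> : S2 = set0.
    apply/setP=> t; rewrite [RHS]inE in_setI; apply/negP => /andP[].
    rewrite !inE flip_diff => h tH; move: h; rewrite (negbTE (outI t _)) ?inE // (negbTE (outIJ t _)) ?inE //.
    rewrite orbF /=; case: (t =P v) => [->|_]; first by rewrite vA eq_sym (negbTE uv).
    by case: (t =P u) => [->|_]; rewrite ?(negbTE uA) ?andbF.
  suff -> : (S1 == set0) = false by rewrite eqxx.
  by apply/negbTE/set0Pn; exists u; rewrite !inE uA !eqxx.
have const X : X \in aff_cube R n -> sreorient A X = X \/ sreorient A X = sopp X.
  move=> XM; have CX := proj1 ((aff_cubeP R X).1 XM).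
  have /set0Pn[u uX] := circuit_neq0 CX.
  have same v : v \in supp X -> (v \in A) = (u \in A).
    move=> vX; have [->//|/eqP/ffunP/existsNP[i vi]] := eqVneq v u.
    (* If [u] and [v] are antipodal, a third vertex [z] of the circuit shares a facet with each of
       them. *)
    have [z [zX zu zi]] := circuit_single i CX uX.
    rewrite -(adj z u i zi); have [->//|zv] := eqVneq v z.
    case: (pselect (exists j, v j = u j)) => [[j e]|no].
      by rewrite (adj v u j e) -(adj z u i zi).
    case: (pselect (exists j, v j = z j)) => [[j e]|no']; first exact: adj e.
    case/eqP: zu; apply/ffunP=> j; apply: contrapT => zj.
    have h1 : v j <> u j by move=> e; apply: no; exists j.
    have h2 : v j <> z j by move=> e; apply: no'; exists j.
    by move: h1 h2 zj; case: (v j) (u j) (z j) => [] [] [].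
  case: (boolP (u \in A)) => uA; [right|left];
    rewrite [RHS]surjective_pairing /=; congr pair; apply/setP=> v; rewrite !inE;
    have := same v; rewrite inE ?uA ?(negbTE uA);
    by case: (v \in X.1) (v \in X.2) (v \in A) => [] [] [] // /(_ isT).
apply/setP=> X; rewrite mem_reorientation; apply/idP/idP => XM.
  have [E|E] := const _ XM; rewrite sreorientK in E; rewrite E //.
  exact: om_symmetric.
by have [->//|->] := const _ XM; apply: om_symmetric.
Qed.

(** * Monochromatic pairs and their potential *)

Section RectangleSigns.
Variables (R : realType) (n : nat) (M : {set signed_set (vertex n)}).
Hypothesis orM : orientation (cube_matroid R n) M.
Implicit Types (u v w x y z : vertex n) (I J K L : {set 'I_n}).

Notation N := (cube_matroid R n).

Let omM : oriented_matroid M := proj1 orM.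

Lemma flip_flip I J v : flip I (flip J v) = flip ((I :\: J) :|: (J :\: I)) v.
Proof.
by apply/ffunP=> i; rewrite !flipE !inE; case: (v i) (i \in I) (i \in J) => [] [] [].
Qed.

Lemma flipU I J v : [disjoint I & J] -> flip (I :|: J) v = flip I (flip J v).
Proof.
move=> d; rewrite flip_flip; congr flip; apply/setP=> i; rewrite !inE.
by have := disjointFr d (x := i); case: (i \in I) => [->//|_]; case: (i \in J).
Qed.

Lemma flipK I : involutive (@flip n I).
Proof. by move=> v; apply/ffunP=> i; rewrite !flipE addbK. Qed.

Lemma diff_flip v J : diff v (flip J v) = J.
Proof. by apply/setP=> i; rewrite !inE flipE; case: (v i) (i \in J) => [] []. Qed.

Lemma supp_rectangleC v I J : supp (rectangle v I J) = supp (rectangle v J I).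
Proof. by rewrite !supp_rectangle [I :|: J]setUC setUAC. Qed.

Lemma supp_rectangle_flip v I J : [disjoint I & J] ->
  supp (rectangle (flip I v) I J) = supp (rectangle v I J).
Proof.
move=> d; have d' : [disjoint J & I] by rewrite disjoint_sym.
have E1 : flip J (flip I v) = flip (I :|: J) v by rewrite setUC flipU.
have E2 : flip (I :|: J) (flip I v) = flip J v by rewrite setUC flipU ?flipK.
rewrite !supp_rectangle flipK E1 E2; apply/setP=> t; rewrite !inE.
by do 4!case: (t == _).
Qed.

Lemma rectangle_exists v I J : I != set0 -> J != set0 -> [disjoint I & J] ->
  exists2 X, X \in M & supp X = supp (rectangle v I J).
Proof. by move=> *; apply: (orientation_exists orM); apply: rectangle_circuit. Qed.

(** Two rectangles share the edge from [v] to [flip J v], and both other sides change the coordinate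
    [i]. Their remaining vertices form a rectangle [F] in the facet opposite to [v], so the pair
    elimination applies. The second conclusion records the signs on [F]; it yields the triangle
    relation. *)
Lemma parallel_sgn_core v J K L i X Y : J != set0 ->
  [disjoint J & K] -> [disjoint J & L] -> i \in K -> i \in L -> K != L ->
  X \in M -> supp X = supp (rectangle v J K) ->
  Y \in M -> supp Y = supp (rectangle v J L) ->
  sgn X v (+) sgn X (flip J v) = sgn Y v (+) sgn Y (flip J v) /\
  (forall W, W \in M ->
     supp W = supp (rectangle (flip K v) J ((K :\: L) :|: (L :\: K))) ->
     sgn W (flip K v) (+) sgn W (flip L v) =
     ~~ (sgn X v (+) sgn X (flip K v) (+) sgn Y v (+) sgn Y (flip L v))).
Proof.
move=> J0 dK dL iK iL KL XM sX YM sY.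
set D := (K :\: L) :|: (L :\: K); set F := supp (rectangle (flip K v) J D).
have D0 : D != set0.
  apply: contra KL => /eqP/setP E; apply/eqP/setP=> j; have := E j; rewrite /D !inE.
  by case: (j \in K) (j \in L) => [] [].
have dD : [disjoint J & D].
  rewrite disjoint_sym disjoints_subset; apply/subsetP=> j; rewrite /D !inE.
  have := disjointFl dK (x := j); have := disjointFl dL (x := j).
  by case: (j \in K) (j \in L) => [] [] h1 h2 //; do ?[rewrite (h1 isT)|rewrite (h2 isT)].
have FE : F = [set flip K v; flip (J :|: L) v; flip (J :|: K) v; flip L v].
  rewrite /F supp_rectangle -(flipU v dK) (flipU (flip K v) dD).
  have -> : flip D (flip K v) = flip L v.
    rewrite flip_flip; congr flip; apply/setP=> j; rewrite /D !inE.
    by case: (j \in K) (j \in L) => [] [].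
  by rewrite -(flipU v dL).
have FC : F \in circuits N by apply: rectangle_circuit.
have FZ Z : Z \in M -> supp Z \subset F -> supp Z = F.
  by move=> ZM; apply: circuit_sub (orientation_circuit orM ZM) FC.
have iJ : i \in J = false by rewrite (disjointFl dK).
have ne (A B : {set 'I_n}) : (exists j, (j \in A) != (j \in B)) ->
    (flip A v == flip B v) = false.
  move=> [j h]; rewrite (inj_eq (@flip_inj _ v)); apply/negbTE.
  by apply: contra h => /eqP ->.
have [j jJ] := set0Pn _ J0.
have jK : j \in K = false by rewrite (disjointFr dK).
have jL : j \in L = false by rewrite (disjointFr dL).
have v0 : v = flip set0 v by apply/ffunP=> t; rewrite flipE inE addbF.
have neKL : exists t, (t \in K) != (t \in L).
  apply: contrapT => h; case/eqP: KL; apply/setP=> t; apply/eqP.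
  by apply: contraPT h => e; apply; exists t.
have xY : flip K v \notin supp Y.
  rewrite sY supp_rectangle !inE {2}v0 !ne //; first by exists j; rewrite ?inE jJ jK.
  - by exists j; rewrite inE jJ jK.
  - by exists i; rewrite iK inE.
have yX : flip L v \notin supp X.
  rewrite sX supp_rectangle !inE {2}v0 !ne //.
  - by have [t ht] := neKL; exists t; rewrite eq_sym.
  - by exists j; rewrite jJ jL.
  - by exists j; rewrite inE jJ jL.
  - by exists i; rewrite iL inE.
have xX : flip K v \in supp X by rewrite sX supp_rectangle !inE eqxx !orbT.
have yY : flip L v \in supp Y by rewrite sY supp_rectangle !inE eqxx !orbT.
have vX : v \in supp X by rewrite sX supp_rectangle !inE eqxx.
have vY : v \in supp Y by rewrite sY supp_rectangle !inE eqxx.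
have wX : flip J v \in supp X by rewrite sX supp_rectangle !inE eqxx !orbT.
have wY : flip J v \in supp Y by rewrite sY supp_rectangle !inE eqxx !orbT.
have XF : supp X \subset F :|: [set v; flip J v].
  rewrite sX supp_rectangle FE; apply/subsetP=> t; rewrite !inE -!orbA.
  by case/or4P=> ->; rewrite ?orbT.
have YF : supp Y \subset F :|: [set v; flip J v].
  rewrite sY supp_rectangle FE; apply/subsetP=> t; rewrite !inE -!orbA.
  by case/or4P=> ->; rewrite ?orbT.
have FH : F \subset ~: facet (v i) i.
  rewrite FE; apply/subsetP=> t; rewrite !inE -!orbA.
  by case/or4P=> /eqP ->; rewrite flipE ?inE ?iK ?iL ?orbT; case: (v i).
have vH : v \in facet (v i) i by rewrite inE.
have wH : flip J v \in facet (v i) i by rewrite inE flipE iJ addbF.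
have hF Z : Z \in M -> supp Z \subset F :|: [set v; flip J v] ->
    (v \in supp Z) = (flip J v \in supp Z).
  move=> ZM ZF; have CZ := orientation_circuit orM ZM.
  have ZF' : supp Z \subset F :|: [set flip J v; v] by rewrite [[set _; v]]setUC.
  apply/idP/idP; first exact: circuit_facet CZ FH wH vH ZF'.
  exact: circuit_facet CZ FH vH wH ZF.
have hxy Z : Z \in M -> supp Z \subset F -> (flip K v \in supp Z) && (flip L v \in supp Z).
  by move=> ZM ZF; rewrite (FZ _ ZM ZF) FE !inE !eqxx !orbT.
split.
  apply: (pair_sgn omM XM YM vX vY wX wY XF YF hF hxy _ xX xY yY yX).
  by move=> Z W ZM WM ZF WF; rewrite (FZ _ ZM ZF) (FZ _ WM WF).
move=> W WM sW.
have hv Z : Z \in M -> supp Z \subset F :|: [set v; flip J v] ->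
    flip J v \in supp Z -> v \in supp Z by move=> ZM ZF; rewrite (hF Z).
have [Z [ZM ZF <-]] := eliminate_pair omM XM YM vX vY XF YF hv hxy xX xY yY yX.
have ZW : supp W = supp Z by rewrite (FZ _ ZM ZF).
by apply: (supp_eq_sgn omM WM ZM ZW); rewrite sW -/F FE !inE eqxx ?orbT.
Qed.

(** If [K] and [L] are disjoint, both are compared with their union, which overlaps each of them. *)
Lemma parallel_sgn v J K L X Y : J != set0 -> K != set0 -> L != set0 ->
  [disjoint J & K] -> [disjoint J & L] ->
  X \in M -> supp X = supp (rectangle v J K) ->
  Y \in M -> supp Y = supp (rectangle v J L) ->
  sgn X v (+) sgn X (flip J v) = sgn Y v (+) sgn Y (flip J v).
Proof.
move=> J0 K0 L0 dK dL XM sX YM sY.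
have [E|KL] := eqVneq K L.
  by apply: (supp_eq_sgn omM XM YM); rewrite ?sX ?sY ?E // supp_rectangle !inE eqxx ?orbT.
case: (set_0Vmem (K :&: L)) => [KL0|[i]]; last first.
  rewrite inE => /andP[iK iL].
  exact: (parallel_sgn_core J0 dK dL iK iL KL XM sX YM sY).1.
have dU : [disjoint J & K :|: L].
  rewrite disjoint_sym disjoints_subset subUset -!disjoints_subset.
  by rewrite ![[disjoint _ & J]]disjoint_sym dK.
have U0 : K :|: L != set0 by rewrite setU_eq0 negb_and K0.
have [[k kK] [l lL]] := (set0Pn _ K0, set0Pn _ L0).
have kL : (k \in L) = false.
  by apply/negP => kL; have := in_set0 k; rewrite -KL0 inE kK kL.
have lK : (l \in K) = false.
  by apply/negP => lK; have := in_set0 l; rewrite -KL0 inE lK lL.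
have [Z ZM sZ] := rectangle_exists v J0 U0 dU.
have KU : K != K :|: L by apply/eqP => /setP/(_ l); rewrite inE lK lL.
have LU : L != K :|: L by apply/eqP => /setP/(_ k); rewrite inE kL kK.
have kU : k \in K :|: L by rewrite inE kK.
have lU : l \in K :|: L by rewrite inE lL orbT.
rewrite (parallel_sgn_core J0 dK dU kK kU KU XM sX ZM sZ).1.
by rewrite (parallel_sgn_core J0 dL dU lL lU LU YM sY ZM sZ).1.
Qed.

(** By [parallel_sgn] every rectangle with this edge gives the same answer. The value is [false] for
    equal and for antipodal vertices, which span no edge of a rectangle. *)
Definition monochromatic u w : bool :=
  [exists X in M, exists K : {set 'I_n},
     [&& K != set0, diff u w != set0, [disjoint diff u w & K],
         supp X == supp (rectangle u (diff u w) K) & sgn X u == sgn X w]].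

Lemma monochromaticE v J K X : J != set0 -> K != set0 -> [disjoint J & K] ->
  X \in M -> supp X = supp (rectangle v J K) ->
  monochromatic v (flip J v) = (sgn X v == sgn X (flip J v)).
Proof.
move=> J0 K0 dK XM sX; rewrite /monochromatic diff_flip.
apply/exists_inP/idP => [[Y YM /existsP[L /and5P[L0 _ dL /eqP sY]]]|e].
  have := parallel_sgn J0 K0 L0 dK dL XM sX YM sY.
  by do 4!case: (sgn _ _).
by exists X => //; apply/existsP; exists K; rewrite K0 J0 dK sX eqxx.
Qed.

Lemma monochromatic_refl u : monochromatic u u = false.
Proof.
rewrite /monochromatic; apply/exists_inP => -[X _ /existsP[K /and5P[_ /set0Pn[i]]]].
by rewrite inE eqxx.
Qed.

(** The same circuit is also a rectangle based at the neighbouring corners. The third item reads the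
    first edge backwards, which gives the symmetry of [monochromatic]. *)
Lemma rectangle_edges v J K X : J != set0 -> K != set0 -> [disjoint J & K] ->
  X \in M -> supp X = supp (rectangle v J K) ->
  [/\ monochromatic v (flip J v) = (sgn X v == sgn X (flip J v)),
      monochromatic v (flip K v) = (sgn X v == sgn X (flip K v)),
      monochromatic (flip J v) v = (sgn X v == sgn X (flip J v)),
      monochromatic (flip J v) (flip (J :|: K) v) =
        (sgn X (flip J v) == sgn X (flip (J :|: K) v)) &
      monochromatic (flip K v) (flip (J :|: K) v) =
        (sgn X (flip K v) == sgn X (flip (J :|: K) v))].
Proof.
move=> J0 K0 dK XM sX; have dK' : [disjoint K & J] by rewrite disjoint_sym.
have sJ : supp X = supp (rectangle (flip J v) J K) by rewrite supp_rectangle_flip.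
have sK : supp X = supp (rectangle (flip K v) J K).
  by rewrite supp_rectangleC supp_rectangle_flip // supp_rectangleC.
split.
- exact: monochromaticE sX.
- by rewrite supp_rectangleC in sX; apply: monochromaticE J0 dK' XM sX.
- by have := monochromaticE J0 K0 dK XM sJ; rewrite flipK eq_sym.
- by rewrite supp_rectangleC in sJ; rewrite setUC flipU //;
    apply: monochromaticE J0 dK' XM sJ.
by rewrite flipU //; apply: monochromaticE K0 dK XM sK.
Qed.

Lemma monochromatic_sym u w : monochromatic u w = monochromatic w u.
Proof.
have [->//|uw] := eqVneq u w; have J0 := diff_neq0 uw.
have [KC|K0] := eqVneq (~: diff u w) set0.
  have no (a b : vertex n) : ~: diff a b = set0 -> monochromatic a b = false.
    move=> E; rewrite /monochromatic; apply/exists_inP.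
    move=> -[X _ /existsP[K /and5P[/set0Pn[i iK] _ d _ _]]].
    have := in_set0 i; rewrite -E in_setC; move: (disjointFl d iK) => -> //.
  rewrite !no //; rewrite -KC; congr (~: _); apply/setP=> i; rewrite !inE.
  by rewrite eq_sym.
have d : [disjoint diff u w & ~: diff u w] by rewrite disjoints_subset setCK.
have [X XM sX] := rectangle_exists u J0 K0 d.
have [h1 _ h2 _ _] := rectangle_edges J0 K0 d XM sX.
by rewrite flip_diff in h1 h2; rewrite h1 h2.
Qed.

(** The three pairs are edges of rectangles with second side [[set i]], two of them based at a
    common apex; the third is the rectangle obtained by elimination in [parallel_sgn_core]. *)
Lemma monochromatic_triangle u v w i : u i = v i -> u i = w i ->
  monochromatic u v (+) monochromatic u w (+) monochromatic v w = false.
Proof.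
have core (a b c : vertex n) j : a i = b i -> a i = c i -> b != c ->
    j \in diff a b -> j \in diff a c ->
    monochromatic a b (+) monochromatic a c (+) monochromatic b c = false.
  move=> ab ac bc jK jL; set K := diff a b; set L := diff a c.
  have J0 : [set i] != set0 by apply/set0Pn; exists i; rewrite inE.
  have dK : [disjoint [set i] & K] by rewrite disjoints1 inE ab eqxx.
  have dL : [disjoint [set i] & L] by rewrite disjoints1 inE ac eqxx.
  have K0 : K != set0 by apply/set0Pn; exists j.
  have L0 : L != set0 by apply/set0Pn; exists j.
  have KL : K != L by apply: contra bc => /eqP E; rewrite -(flip_diff a b) -/K E flip_diff.
  set D := (K :\: L) :|: (L :\: K).
  have DE : D = diff b c.
    by apply/setP=> t; rewrite !inE; case: (a t) (b t) (c t) => [] [] [].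
  have D0 : D != set0 by rewrite DE; apply: diff_neq0.
  have dD : [disjoint [set i] & D] by rewrite DE disjoints1 inE -ab -ac eqxx.
  have [X XM sX] := rectangle_exists a J0 K0 dK.
  have [Y YM sY] := rectangle_exists a J0 L0 dL.
  have [W WM sW] := rectangle_exists (flip K a) J0 D0 dD.
  have [_ /(_ W WM sW)] := parallel_sgn_core J0 dK dL jK jL KL XM sX YM sY.
  have [_ hX _ _ _] := rectangle_edges J0 K0 dK XM sX.
  have [_ hY _ _ _] := rectangle_edges J0 L0 dL YM sY.
  have [_ hW _ _ _] := rectangle_edges J0 D0 dD WM sW.
  move: hX hY hW; rewrite DE !flip_diff => -> -> ->.
  by do 6!case: (sgn _ _).
move=> uv uw; have [E|nuv] := eqVneq u v.
  by rewrite E monochromatic_refl addbb.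
have [E|nuw] := eqVneq u w.
  by rewrite E monochromatic_refl addbF monochromatic_sym addbb.
have [E|nvw] := eqVneq v w.
  by rewrite E monochromatic_refl addbF addbb.
case: (pselect (exists j, j \in diff u v /\ j \in diff u w)) => [[j [h1 h2]]|no].
  exact: (core _ _ _ j).
(* The apex must differ from both other vertices in a common coordinate. If [u] does not, [v] does:
   where it differs from [u], [w] agrees with [u]. *)
have [j jK] := set0Pn _ (diff_neq0 nuv).
have := core v u w j (esym uv) _ nuw; rewrite -uv uw => /(_ erefl).
rewrite (monochromatic_sym v u) => h; rewrite addbAC; apply: h.
  by move: jK; rewrite !inE eq_sym.
have : j \notin diff u w by apply/negP => h; apply: no; exists j.
by move: jK; rewrite !inE; case: (u j) (v j) (w j) => [] [] [].
Qed.

(* The coordinatewise majority of u, v and w shares a facet with every two of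
   them, so a pairwise non-antipodal triangle is a sum of three triangles each
   lying in a facet. *)
Lemma monochromatic_majority u v w i j k : u i = v i -> v j = w j -> u k = w k ->
  monochromatic u v (+) monochromatic u w (+) monochromatic v w = false.
Proof.
move=> ui vj uk; pose m : vertex n := [ffun t => if u t == v t then u t else w t].
have mi : u i = m i by rewrite ffunE ui eqxx.
have mj : v j = m j by rewrite ffunE -vj; case: eqP.
have mk : u k = m k by rewrite ffunE -uk; case: eqP.
have := monochromatic_triangle ui mi.
have := monochromatic_triangle vj mj.
have := monochromatic_triangle uk mk.
by do 6!case: (monochromatic _ _).
Qed.

(** The potential at [u] is the value on the pair formed by a base vertex [b] and [u]. This says
    nothing about the antipode [b'] of [b], whose potential is the common value of the sums over the
    paths from [b] to [b'] through one further vertex. *)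
Lemma monochromatic_potential : exists t : vertex n -> bool,
  forall u v i, u i = v i -> monochromatic u v = t u (+) t v.
Proof.
pose b : vertex n := [ffun=> false]; pose b' : vertex n := [ffun=> true].
have meet u v : u != flip setT v -> exists i, u i = v i.
  move=> /eqP/ffunP/existsNP[i]; rewrite flipE inE addbT => h; exists i.
  by move: h; case: (u i) (v i) => [] [].
have b'E : flip setT b = b' by apply/ffunP=> i; rewrite flipE !ffunE inE.
have bE : flip setT b' = b by apply/ffunP=> i; rewrite flipE !ffunE inE.
have meetb u : u != b' -> exists i, b i = u i.
  by rewrite -b'E => /meet[i]; exists i.
have meetb' u : u != b -> exists i, b' i = u i.
  by rewrite -bE => /meet[i]; exists i.
(* Independence of the middle vertex: two triangles if [v] and [w] are not antipodal, and otherwise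
   the rectangle with corners [b], [v], [b'], [w]. *)
have through v w : v != b -> v != b' -> w != b -> w != b' ->
    monochromatic b v (+) monochromatic b' v = monochromatic b w (+) monochromatic b' w.
  move=> vb vb' wb wb'.
  have [[i1 e1] [i2 e2]] := (meetb v vb', meetb' v vb).
  have [[i3 e3] [i4 e4]] := (meetb w wb', meetb' w wb).
  have [E|/meet[j vw]] := eqVneq v (flip setT w); last first.
    have := monochromatic_majority e1 vw e3; have := monochromatic_majority e2 vw e4.
    by do 5!case: (monochromatic _ _).
  have J0 : diff b w != set0 by apply: diff_neq0; rewrite eq_sym.
  have K0 : ~: diff b w != set0 by apply/set0Pn; exists i3; rewrite !inE e3 eqxx.
  have d : [disjoint diff b w & ~: diff b w] by rewrite disjoints_subset setCK.
  have [X XM sX] := rectangle_exists b J0 K0 d.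
  have := rectangle_edges J0 K0 d XM sX; rewrite setUCr b'E flip_diff.
  have -> : flip (~: diff b w) b = v.
    by rewrite E; apply/ffunP=> t; rewrite !flipE !inE !ffunE; case: (w t).
  rewrite (monochromatic_sym w b') (monochromatic_sym v b') => -[-> -> _ -> ->].
  by do 4!case: (sgn _ _).
(* The existential extracts the common value, and is [false] if there is no further vertex. *)
pose s := [exists w, [&& w != b, w != b' & monochromatic b w (+) monochromatic b' w]].
have sE v : v != b -> v != b' -> monochromatic b' v = s (+) monochromatic b v.
  move=> vb vb'; suff -> : s = monochromatic b v (+) monochromatic b' v.
    by do 2!case: (monochromatic _ _).
  apply/existsP/idP => [[w /and3P[wb wb']]|h]; first by rewrite (through w v).
  by exists v; rewrite vb vb'.
exists (fun u => if u == b' then s else monochromatic b u) => u v i ui.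
have bb' : b i <> b' i by rewrite !ffunE.
have [ub'|ub'] := eqVneq u b'; have [vb'|vb'] := eqVneq v b'.
- by rewrite ub' vb' monochromatic_refl addbb.
- have [vb|vb] := eqVneq v b; first by case: bb'; rewrite -vb -ub' ui.
  by rewrite ub' sE.
- have [ub|ub] := eqVneq u b; first by case: bb'; rewrite -ub -vb' ui.
  by rewrite vb' monochromatic_sym sE // addbC.
have [[j uj] [k vk]] := (meetb u ub', meetb v vb').
have := monochromatic_majority uj ui vk.
by do 3!case: (monochromatic _ _).
Qed.

Lemma rectangles_reorientation :
  exists A : {set vertex n}, rectangle_family n \subset reorientation A M.
Proof.
have [t ht] := monochromatic_potential; exists [set u | t u].
set A := [set u | t u].
apply/subsetP=> Q; rewrite inE => /existsP[v /existsP[I /existsP[J /and4P[I0 J0 d hQ]]]].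
have [X XM sX] := rectangle_exists v I0 J0 d.
(* This is the sign after reorientation. An edge has equal signs in [X] exactly when [t] differs at
   its ends, so [s] alternates around the rectangle. *)
pose s u := sgn X u (+) t u.
have [[i iI] [j jJ]] := (set0Pn _ I0, set0Pn _ J0).
have iJ : i \in J = false by rewrite (disjointFr d).
have jI : j \in I = false by rewrite (disjointFl d).
have [e1 e2 _ e3 _] := rectangle_edges I0 J0 d XM sX.
(* The potential formula needs a common coordinate: [j] is unchanged by flipping [I], and [i] by
   flipping [J]; in the third edge [i] is flipped at both ends. *)
rewrite (ht _ _ j) ?flipE ?jI ?addbF // in e1.
rewrite (ht _ _ i) ?flipE ?iJ ?addbF // in e2.
rewrite (ht _ _ i) ?flipE ?inE ?iI // in e3.
have s1 : s (flip I v) = ~~ s v.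
  by rewrite /s; move: e1; case: (t v); case: (t _); do 2!case: (sgn _ _).
have s2 : s (flip J v) = ~~ s v.
  by rewrite /s; move: e2; case: (t v); case: (t _); do 2!case: (sgn _ _).
have s3 : s (flip (I :|: J) v) = s v.
  apply: negb_inj; rewrite -s1 /s.
  by move: e3; do 2!case: (t _); do 2!case: (sgn _ _).
have rE : sreorient A X =
    ([set u in supp X | ~~ s u], [set u in supp X | s u]).
  congr pair; apply/setP=> u; have := @sgn_fst _ M omM X u XM; rewrite !inE /s /sgn;
    case: (u \in X.1) (u \in X.2) (t u) => [] [] [] //= h; by have := h isT.
have opM : sopp X \in M by apply: om_symmetric.
have main : sreorient A X = if s v then sopp (rectangle v I J) else rectangle v I J.
  have dQ := rectangle_sdisjoint v I0 J0 d.
  have sQ u : u \in supp X -> s u = (u \in (rectangle v I J).2) (+) s v.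
    rewrite sX /supp in_setU => /orP[u1|u2].
      rewrite (disjointFr dQ u1); move: u1; rewrite !inE.
      by case/orP=> /eqP ->; rewrite ?s3.
    by rewrite u2; move: u2; rewrite !inE; case/orP=> /eqP ->; rewrite ?s1 ?s2.
  have Q1 u : u \in supp X -> (u \in (rectangle v I J).1) = ~~ (u \in (rectangle v I J).2).
    rewrite sX /supp in_setU => /orP[u1|u2]; first by rewrite u1 (disjointFr dQ u1).
    by rewrite u2 (disjointFl dQ u2).
  have sub u : (u \in (rectangle v I J).1) || (u \in (rectangle v I J).2) = (u \in supp X).
    by rewrite sX /supp [RHS]in_setU.
  rewrite rE; move: sQ Q1 sub; case: (rectangle v I J) => [P1 P2] /= sQ Q1 sub.
  by case: (boolP (s v)) => sv; congr pair; apply/setP=> u; rewrite in_set;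
    have := sub u; have := sQ u; have := Q1 u; rewrite ?sv ?(negbTE sv);
    case: (u \in supp X) => /= [/(_ isT) -> /(_ isT) ->|_ _];
    rewrite ?addbT ?addbF ?negbK //;
    case: (u \in P1) (u \in P2) => [] [].
rewrite mem_reorientation.
have RM : sreorient A (rectangle v I J) \in M.
  have := sreorientK A X; rewrite main; case: (s v) => [E|->//].
  by rewrite -E in opM.
case/orP: hQ => /eqP -> //; rewrite sreorient_sopp; exact: om_symmetric.
Qed.

End RectangleSigns.

Theorem theorem3p2 (R : realType) (n : nat) (n_ge1 : (1 <= n)%N) :
  [<-> forall M M' : {set signed_set (vertex n)},
         orientation (cube_matroid R n) M ->
         orientation (cube_matroid R n) M' ->
         exists A : {set vertex n}, M' = reorientation A M;
       forall M : {set signed_set (vertex n)},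
         orientation (cube_matroid R n) M ->
         facet_family n \subset signed_cocircuits M ->
         M = aff_cube R n;
       forall M : {set signed_set (vertex n)},
         orientation (cube_matroid R n) M ->
         rectangle_family n \subset M ->
         M = aff_cube R n].
Proof.
tfae.
- move=> uniq M orM FM; have [A E] := uniq _ _ (aff_cube_orientation R n) orM.
  by rewrite E in FM *; apply: aff_cube_facet_reorientation.
- move=> facets M orM RM; apply: facets => //.
  exact: facets_of_rectangles orM RM.
(* Both orientations are reoriented to contain the rectangles and thus become the affine one; the
   symmetric difference of the two sets leads from [M] to [M']. *)
move=> rects M M' orM orM'.
have [A /(rects _ (reorientation_orientation A orM)) EA] := rectangles_reorientation orM.
have [B /(rects _ (reorientation_orientation B orM')) EB] := rectangles_reorientation orM'.
exists ((A :\: B) :|: (B :\: A)).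
by rewrite -reorientation_comp EA -EB reorientationK.
Qed.
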